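(* For every $n\in\mathbb{N}$ let $\sigma=\sigma_n$ be a uniformly distributed random permutation in the symmetric group $\mathcal{S}_n$ and let $$C_n=\frac{1}{n}\sum_{k=1}^n \sigma(k)\, e^{2\pi i k/n}.$$ Let $X_n=\frac{1}{\sqrt{n}}\operatorname{Re}[C_n]$ and $Y_n=\frac{1}{\sqrt{n}}\operatorname{Im}[C_n]$. Then the distribution of $(X_n,Y_n)^T$ converges weakly, as $n\to\infty$, to a two-dimensional Gaussian distribution with mean $(0,0)^T$ and covariance matrix $$\Gamma=\begin{pmatrix}\frac{1}{24}&0\\ 0&\frac{1}{24}\end{pmatrix}.$$ In particular, $Z_n=\frac{1}{\sqrt{n}}C_n$ converges weakly, as $n\to\infty$, to a circularly-symmetric centered complex normal distribution with variance $\frac{1}{12}$.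
   Context: $C_n$ is the centroid of the random polygon with vertices $\sigma(1)\zeta_n,\sigma(2)\zeta_n^2,\dots,\sigma(n)\zeta_n^n$, where $\zeta_n=e^{2\pi i/n}$. *)

(* Defs.v *)
From HB Require Import structures.
From mathcomp Require Import all_boot all_order all_algebra all_fingroup.
From mathcomp Require Import all_classical all_reals all_analysis.
Set Implicit Arguments. Unset Strict Implicit. Unset Printing Implicit Defensive.
Import Order.TTheory GRing.Theory Num.Theory.
Import numFieldNormedType.Exports.
Local Open Scope ring_scope.

(* A permutation s : 'S_n of 'I_n = {0,...,n-1} encodes the permutation
   k |-> (s (k-1)) + 1 of {1,...,n}.  So sigma(k) = (s i).+1 with k = i.+1. *)

Definition ReC (R : realType) (n : nat) (s : 'S_n) : R :=
  n%:R^-1 * \sum_(i < n) ((s i).+1)%:R * cos (2 * pi * (i.+1)%:R / n%:R).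

Definition ImC (R : realType) (n : nat) (s : 'S_n) : R :=
  n%:R^-1 * \sum_(i < n) ((s i).+1)%:R * sin (2 * pi * (i.+1)%:R / n%:R).

Definition XY (R : realType) (n : nat) (s : 'S_n) : R * R :=
  ((Num.sqrt n%:R)^-1 * ReC R s, (Num.sqrt n%:R)^-1 * ImC R s).

Definition expect_perm (R : realType) (n : nat) (g : R * R -> R) : R :=
  (n`!)%:R^-1 * \sum_(s : 'S_n) g (XY R s).

Definition gauss2_density (R : realType) (v : R) (z : R * R) : R :=
  (2 * pi * v)^-1 * expR (- (z.1 ^+ 2 + z.2 ^+ 2) / (2 * v)).

(* Main.v *)
Require Import Defs.
From HB Require Import structures.
From mathcomp Require Import all_boot all_order all_algebra all_fingroup.
From mathcomp Require Import all_classical all_reals all_analysis.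
From mathcomp Require Import measurable_realfun ring lra.
(* Characteristic functions, by Stein's method.  A linear statistic
   [T = \sum_i c_i y_(sigma i)] with [\sum_i c_i = 0], together with its value
   after transposing two uniformly chosen positions, forms an exchangeable pair.
   This expresses [E (T f(T))] through increments of [f], so that
   [phi(t) = E cos (t T + r)] satisfies [phi' = - v t phi + O(n^(-1/2))], which is
   the equation of the Gaussian characteristic function of variance [v], up to
   the fluctuations of the sum of the squared increments.  For
   [T = a X_n + b Y_n] that sum is explicit; it concentrates at
   [v = (a^2 + b^2) / 24] because [\sum_k zeta^k] and [\sum_k zeta^(2k)] vanish.

   To pass from cosines to a bounded continuous [g], approximate [g] on a box of
   radius [L] by Bernstein polynomials in [sin (x / L)] and [sin (y / L)].  These
   are trigonometric polynomials and remain bounded on the whole plane, so second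
   moments control the error outside the box. *)

Import Order.TTheory GRing.Theory Num.Theory.
Import numFieldNormedType.Exports.
Local Open Scope classical_set_scope.
Local Open Scope ring_scope.

(** * Linear statistics of a uniform permutation and their exchangeable pair *)

Section UniformPermutation.
Variables (R : realType) (n : nat).
Implicit Types (F G : 'S_n -> R) (c y : 'I_n -> R) (s : 'S_n).

(** The normalisation is that of [expect_perm], but for an arbitrary function of the permutation, so
    that [expect_perm n g] unfolds to an [Eperm]. *)
Definition Eperm F : R := (n`!)%:R^-1 * \sum_(s : 'S_n) F s.

Lemma card_perm_neq0 : (n`!)%:R != 0 :> R.
Proof. by rewrite pnatr_eq0 -lt0n fact_gt0. Qed.

Lemma EpermD F G : Eperm (fun s => F s + G s) = Eperm F + Eperm G.
Proof. by rewrite /Eperm big_split mulrDr. Qed.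

Lemma EpermZ (k : R) F : Eperm (fun s => k * F s) = k * Eperm F.
Proof. by rewrite /Eperm -mulr_sumr mulrCA. Qed.

Lemma EpermB F G : Eperm (fun s => F s - G s) = Eperm F - Eperm G.
Proof. by rewrite /Eperm sumrB mulrBr. Qed.

Lemma Eperm_cst (k : R) : Eperm (fun=> k) = k.
Proof.
rewrite /Eperm sumr_const card_Sn -[k in LHS]mul1r -mulrnAl.
by rewrite mulrA mulVf ?mul1r// card_perm_neq0.
Qed.

Lemma le_Eperm F G : (forall s, F s <= G s) -> Eperm F <= Eperm G.
Proof. by move=> FG; rewrite ler_wpM2l ?invr_ge0//; exact: ler_sum. Qed.

Lemma eq_Eperm F G : (forall s, F s = G s) -> Eperm F = Eperm G.
Proof. by move=> FG; rewrite /Eperm; congr (_ * _); apply: eq_bigr. Qed.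

Lemma ler_norm_Eperm F : `|Eperm F| <= Eperm (fun s => `|F s|).
Proof.
rewrite /Eperm normrM ger0_norm ?invr_ge0//.
by rewrite ler_wpM2l ?invr_ge0// ler_norm_sum.
Qed.

Lemma Eperm_mulg (t : 'S_n) F : Eperm (fun s => F (t * s)%g) = Eperm F.
Proof.
rewrite /Eperm; congr (_ * _).
rewrite [RHS](reindex_inj (mulgI t)); exact: eq_bigr.
Qed.

Lemma Eperm_sum (I : finType) (H : I -> 'S_n -> R) :
  Eperm (fun s => \sum_i H i s) = \sum_i Eperm (H i).
Proof. by rewrite /Eperm exchange_big mulr_sumr. Qed.

Definition permstat c y s : R := \sum_i c i * y (s i).

Definition swapdiff c y s i j : R := (c i - c j) * (y (s j) - y (s i)).

(** Products of permutations act from the left factor first, so [tperm i j * s] exchanges the values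
    of [s] at the positions [i] and [j]; only these two summands change. *)
Lemma permstat_swap c y s i j :
  permstat c y (tperm i j * s)%g = permstat c y s + swapdiff c y s i j.
Proof.
rewrite /permstat /swapdiff; have [<-|ij] := eqVneq i j.
  by rewrite tperm1 mul1g !subrr mul0r addr0.
rewrite (bigD1 i)//= (bigD1 j) 1?eq_sym//= [in RHS](bigD1 i)//=.
rewrite [X in _ = _ + X + _](bigD1 j) 1?eq_sym//= !permM tpermL tpermR.
rewrite (eq_bigr (fun k => c k * y (s k))); first by ring.
by move=> k /andP[ki kj]; rewrite permM tpermD // eq_sym.
Qed.

Lemma swapdiff_swap c y s i j :
  swapdiff c y (tperm i j * s)%g i j = - swapdiff c y s i j.
Proof. by rewrite /swapdiff !permM tpermL tpermR; ring. Qed.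

(** The linear regression property of Stein's pair: averaged over the [n ^ 2] ordered pairs, the
    increment is [- 2 T / n]. The mixed terms vanish because [c] sums to zero. *)
Lemma sum_swapdiff c y s : \sum_i c i = 0 ->
  \sum_i \sum_j swapdiff c y s i j = - (2 * n%:R * permstat c y s).
Proof.
move=> c0; rewrite /permstat.
have E i j : swapdiff c y s i j = c i * y (s j) - c i * y (s i)
     - c j * y (s j) + y (s i) * c j by rewrite /swapdiff; ring.
under eq_bigr => i _ do under eq_bigr => j _ do rewrite E.
under eq_bigr => i _.
  rewrite big_split !sumrB /= -!mulr_sumr c0 mulr0 addr0 sumr_const card_ord.
  over.
rewrite !sumrB -mulr_suml c0 mul0r sub0r sumr_const card_ord.
have -> : \sum_i c i * (y (s i) *+ n) = (\sum_i c i * y (s i)) *+ n.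
  by rewrite -sumrMnl; apply: eq_bigr => i _; rewrite mulrnAr.
by ring.
Qed.

(* Transposing two positions preserves the uniform law and flips the sign of
   [swapdiff]: this is the exchangeable pair of Stein's method. *)
Lemma Eperm_swap c y (f : R -> R) : \sum_i c i = 0 ->
  Eperm (fun s => \sum_i \sum_j swapdiff c y s i j *
      (f (permstat c y s + swapdiff c y s i j) - f (permstat c y s))) =
  4 * n%:R * Eperm (fun s => permstat c y s * f (permstat c y s)).
Proof.
move=> c0; rewrite -EpermZ.
have -> : Eperm (fun s => 4 * n%:R * (permstat c y s * f (permstat c y s))) =
   - 2 * \sum_i \sum_j Eperm (fun s => swapdiff c y s i j * f (permstat c y s)).
  under [in RHS]eq_bigr do rewrite -Eperm_sum.
  rewrite -Eperm_sum -EpermZ; apply: eq_Eperm => s.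
  under eq_bigr do rewrite -mulr_suml.
  by rewrite -mulr_suml sum_swapdiff//; ring.
rewrite Eperm_sum mulr_sumr; apply: eq_bigr => i _.
rewrite Eperm_sum mulr_sumr; apply: eq_bigr => j _.
set T := permstat c y; set U := fun s => swapdiff c y s i j.
have swapE : Eperm (fun s => U s * f (T s + U s)) =
             - Eperm (fun s => U s * f (T s)).
  rewrite -[RHS]mulN1r -EpermZ -[RHS](Eperm_mulg (tperm i j)).
  by apply: eq_Eperm => s; rewrite /U swapdiff_swap /T permstat_swap; ring.
under eq_Eperm do rewrite mulrBr.
by rewrite EpermB swapE; ring.
Qed.

Lemma ler_swapdiff c y (D Y : R) s i j :
  (forall i, `|c i| <= D) -> (forall i, `|y i| <= Y) ->
  `|swapdiff c y s i j| <= 4 * D * Y.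
Proof.
move=> cD yY; rewrite normrM (_ : 4 * D * Y = (D + D) * (Y + Y)); last by ring.
by apply: ler_pM => //; apply: (le_trans (ler_normB _ _)); exact: lerD.
Qed.

(** With [f := id], [Eperm_swap] turns the second moment into the mean of [n ^ 2] squared
    increments, each at most [(4 D Y) ^ 2]. *)
Lemma Eperm_permstat2_le c y (D Y : R) : (0 < n)%N ->
  \sum_i c i = 0 -> (forall i, `|c i| <= D) -> (forall i, `|y i| <= Y) ->
  Eperm (fun s => permstat c y s ^+ 2) <= 4 * n%:R * D ^+ 2 * Y ^+ 2.
Proof.
move=> n0 c0 cD yY.
have n0' : 0 < 4 * n%:R :> R by rewrite mulr_gt0 ?ltr0n.
rewrite -(ler_pM2l n0') -(Eperm_swap c y id c0).
rewrite -[leRHS]Eperm_cst; apply: le_Eperm => s.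
have -> : 4 * n%:R * (4 * n%:R * D ^+ 2 * Y ^+ 2) =
   \sum_(i < n) \sum_(j < n) (4 * D * Y) ^+ 2.
  by rewrite !sumr_const card_ord; ring.
apply: ler_sum => i _; apply: ler_sum => j _.
rewrite addrAC subrr add0r -expr2 -real_normK ?num_real//.
by rewrite ler_pXn2r ?nnegrE// ?(le_trans _ (ler_swapdiff c y D Y s i j cD yY)) ?ler_swapdiff.
Qed.

(** Once [c] and [y] are centred, the quadratic variation consists of a deterministic product, a
    multiple of [T ^ 2], and another linear statistic, built on the squares, to which the same
    second moment bound can be applied after centring. *)
Lemma sum_swapdiff2 c y s : \sum_i c i = 0 -> \sum_i y i = 0 ->
  \sum_i \sum_j swapdiff c y s i j ^+ 2 =
  2 * n%:R * permstat (fun i => c i ^+ 2) (fun i => y i ^+ 2) s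
  + 2 * (\sum_i c i ^+ 2) * (\sum_i y i ^+ 2) + 4 * permstat c y s ^+ 2.
Proof.
move=> c0 y0; rewrite /permstat.
have ys (f : R -> R) : \sum_i f (y (s i)) = \sum_i f (y i).
  by rewrite [RHS](reindex_inj (@perm_inj _ s)).
have y0' : \sum_i y (s i) = 0 by rewrite (ys id).
(* In each product the factor free of [j] stands on the left, ready to be pulled out of the inner
   sum by [mulr_sumr]. *)
have E i j : swapdiff c y s i j ^+ 2 =
     c i ^+ 2 * y (s i) ^+ 2 + c j ^+ 2 * y (s j) ^+ 2
     + c i ^+ 2 * y (s j) ^+ 2 + y (s i) ^+ 2 * c j ^+ 2
     - 2 * c i ^+ 2 * y (s i) * y (s j) - 2 * y (s i) * (c j ^+ 2 * y (s j))
     - 2 * c i * y (s i) ^+ 2 * c j - 2 * c i * (c j * y (s j) ^+ 2)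
     + 4 * (c i * y (s i)) * (c j * y (s j)) by rewrite /swapdiff; ring.
have F i : \sum_j swapdiff c y s i j ^+ 2 =
    n%:R * (c i ^+ 2 * y (s i) ^+ 2) + \sum_j c j ^+ 2 * y (s j) ^+ 2
    + c i ^+ 2 * (\sum_j y j ^+ 2) + y (s i) ^+ 2 * (\sum_j c j ^+ 2)
    - y (s i) * (2 * \sum_j c j ^+ 2 * y (s j))
    - c i * (2 * \sum_j c j * y (s j) ^+ 2)
    + c i * y (s i) * (4 * \sum_j c j * y (s j)).
  under eq_bigr => j _ do rewrite E.
  rewrite !(big_split, sumrN) /= -!mulr_sumr c0 y0' sumr_const card_ord.
  by rewrite (ys (fun u => u ^+ 2)); ring.
under eq_bigr => i _ do rewrite F.
rewrite !(big_split, sumrN) /= -!mulr_sumr -!mulr_suml c0 y0' sumr_const card_ord.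
by rewrite (ys (fun u => u ^+ 2)); ring.
Qed.

End UniformPermutation.

(** * Mean value estimates and a Gronwall inequality for the Gaussian equation *)

Section MeanValue.
Variable R : realType.
Implicit Types (f df : R -> R) (x y K : R).

Lemma is_derive_ext (f g : R -> R) x (a : R) :
  f =1 g -> is_derive x 1 f a -> is_derive x 1 g a.
Proof. by move=> /funext ->. Qed.

Lemma is_derive_cos_affine (t x c : R) :
  is_derive t 1 (fun t => cos (t * x + c)) (- (x * sin (t * x + c))).
Proof.
have h : is_derive t 1 (fun t : R => t * x + c) x.
  apply: (@is_derive_ext ((x \*: id) + cst c)) => [u|].
    by rewrite !fctE /= mulrC.
  by apply: is_derive_eq; rewrite addr0 /GRing.scale/= mulr1.
apply: (@is_derive_eq _ _ _ (cos \o (fun t => t * x + c))).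
by rewrite /=; ring.
Qed.

(** The endpoints may come in either order, since increments have no fixed sign; the intermediate
    point is located only by its distance to [x]. *)
Lemma mean_value f df x y : (forall t : R, is_derive t (1:R) f (df t)) ->
  exists2 t, `|t - x| <= `|y - x| & f y - f x = df t * (y - x).
Proof.
move=> fdf.
have cf a b : {within `[a, b], continuous f}.
  apply: derivable_within_continuous => t _; exact: ex_derive.
have [xy|/ltW yx] := leP x y.
  have [t /[!in_itv]/= /andP[xt ty] ->] := MVT_segment xy (fun t _ => fdf t) (cf _ _).
  by exists t => //; rewrite !ger0_norm ?subr_ge0 ?lerD2r.
have [t /[!in_itv]/= /andP[xt ty] E] := MVT_segment yx (fun t _ => fdf t) (cf _ _).
exists t; last by rewrite -opprB E; ring.
by rewrite (distrC t) (distrC y) !ger0_norm ?subr_ge0 ?lerD2l ?lerN2.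
Qed.

Lemma ler_dist_cos x y : `|cos y - cos x| <= `|y - x|.
Proof.
have [t _ ->] := mean_value _ _ x y (@is_derive_cos R).
rewrite normrM normrN ler_piMl//.
by rewrite ler_norml sin_geN1 sin_le1.
Qed.

(** The mean value theorem for [sin], followed by the Lipschitz bound of [cos] at the intermediate
    point; this gives the constant 1 instead of the optimal 1/2. *)
Lemma sin_taylor1 x d : `|sin (x + d) - sin x - d * cos x| <= d ^+ 2.
Proof.
have [t tx E] := mean_value _ _ x (x + d) (@is_derive_sin R).
rewrite E addrAC subrr add0r (mulrC d) -mulrBl normrM -real_normK ?num_real// expr2.
apply: ler_wpM2r => //; apply: (le_trans (ler_dist_cos _ _)).
by move: tx; rewrite addrAC subrr add0r.
Qed.

Lemma expR_halfsqr_derive (v t : R) :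
  is_derive t 1 (fun t => expR (v / 2 * t ^+ 2)) (v * t * expR (v / 2 * t ^+ 2)).
Proof.
have h : is_derive t 1 (fun t : R => v / 2 * t ^+ 2) (v * t).
  apply: (@is_derive_ext ((v / 2) \*: (id ^+ 2))) => [u|] //.
  by apply: is_derive_eq; rewrite /GRing.scale/= expr1 mulr1; field.
apply: (@is_derive_eq _ _ _ (expR \o (fun t : R => v / 2 * t ^+ 2))).
by rewrite /=; ring.
Qed.

(** Multiplying by the integrating factor [expR (v / 2 * t ^+ 2)] leaves a derivative made of the
    defect alone. The mean value theorem on [[0, 1]] concludes, as the factor there is at most its
    value at 1. It serves approximately for permutations and with [e = 0] for the Gaussian. *)
Lemma gronwall_gauss (phi dphi : R -> R) (v e : R) : 0 <= v ->
  (forall t : R, is_derive t (1:R) phi (dphi t)) ->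
  (forall t, `|t| <= 1 -> `|dphi t + v * t * phi t| <= e) ->
  `|phi 1 - phi 0 * expR (- (v / 2))| <= e.
Proof.
move=> v0 dphiP phie.
pose G := phi * (fun t => expR (v / 2 * t ^+ 2)).
have GE (t : R) : is_derive t (1:R) G
    ((dphi t + v * t * phi t) * expR (v / 2 * t ^+ 2)).
  have h1 := dphiP t; have h2 := expR_halfsqr_derive v t.
  apply: is_derive_eq; rewrite /GRing.scale/=; ring.
have [t] := mean_value _ _ 0 1 GE.
rewrite /G !fctE !subr0 normr1 mulr1 expr1n expr0n/= !mulr0 !mulr1 expR0 mulr1 => t1 E.
have -> : phi 1 - phi 0 * expR (- (v / 2)) =
    (dphi t + v * t * phi t) * expR (v / 2 * t ^+ 2 - v / 2).
  rewrite expRD expRN mulrA -E mulrBl mulfK//.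
  by rewrite gt_eqF ?expR_gt0.
rewrite normrM (ger0_norm (expR_ge0 _)).
apply: le_trans (phie t t1); rewrite ler_piMr//.
rewrite -expR0 ler_expR subr_le0 ler_piMr ?divr_ge0//.
by rewrite -real_normK ?num_real// expr_le1.
Qed.

End MeanValue.

(** * Stein's bound on the characteristic function of a linear statistic *)

Section SteinBound.
Variables (R : realType) (n : nat).
Implicit Types (c y : 'I_n -> R) (s : 'S_n).

Lemma is_derive_Eperm (F dF : 'S_n -> R -> R) (t : R) :
  (forall s, is_derive t 1 (F s) (dF s t)) ->
  is_derive t 1 (fun t => Eperm R n (F ^~ t)) (Eperm R n (dF ^~ t)).
Proof.
move=> FdF; rewrite /Eperm.
apply: (@is_derive_ext _ ((n`!)%:R^-1 \*: (\sum_(s : 'S_n) F s))) => [u|].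
  by rewrite /= fct_sumE.
apply: is_deriveZ.
by elim/big_ind2 : _ => // [|] *; [exact: is_derive_cst|exact: is_deriveD].
Qed.

(* Stein's method: comparing [Eperm_swap] for [f := sin (t x + c)] with its
   first-order expansion shows that the characteristic function nearly satisfies
   the differential equation [phi' = - v t phi] of the Gaussian one. *)
Lemma Eperm_cos_permstat c y (D Y v e r : R) : (0 < n)%N -> 0 <= v ->
  \sum_i c i = 0 -> (forall i, `|c i| <= D) -> (forall i, `|y i| <= Y) ->
  Eperm R n (fun s =>
    `|(4 * n%:R)^-1 * (\sum_i \sum_j swapdiff R n c y s i j ^+ 2) - v|) <= e ->
  `|Eperm R n (fun s => cos (permstat R n c y s + r)) - cos r * expR (- (v / 2))|
    <= e + 16 * n%:R * (D * Y) ^+ 3.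
Proof.
move=> n0 v0 c0 cD yY Qe.
pose T := permstat R n c y; pose U := swapdiff R n c y.
pose N : R := 4 * n%:R.
have N0 : 0 < N by rewrite mulr_gt0 ?ltr0n.
have DY0 : 0 <= D * Y.
  by rewrite mulr_ge0// (le_trans _ (cD (Ordinal n0)), le_trans _ (yY (Ordinal n0))).
pose phi t := Eperm R n (fun s => cos (t * T s + r)).
pose dphi t := Eperm R n (fun s => - (T s * sin (t * T s + r))).
have -> : Eperm R n (fun s => cos (permstat R n c y s + r)) = phi 1.
  by apply: eq_Eperm => s; rewrite mul1r.
have -> : cos r = phi 0.
  rewrite -(Eperm_cst R n (cos r)); apply: eq_Eperm => s.
  by rewrite mul0r add0r.
apply: (gronwall_gauss R phi dphi v _ v0) => [t|t t1].
  apply: (is_derive_Eperm (fun s t => cos (t * T s + r))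
    (fun s t => - (T s * sin (t * T s + r)))) => s.
  exact: is_derive_cos_affine.
pose Q s := \sum_i \sum_j U s i j ^+ 2.
(* The increment times the Taylor remainder of the sine; the first-order part that is subtracted
   sums to the quadratic variation [Q]. *)
pose rho s i j := U s i j *
  (sin (t * (T s + U s i j) + r) - sin (t * T s + r) -
   t * U s i j * cos (t * T s + r)).
have E : dphi t + v * t * phi t =
   Eperm R n (fun s => - (t * cos (t * T s + r) * (N^-1 * Q s - v)))
   - N^-1 * Eperm R n (fun s => \sum_i \sum_j rho s i j).
  have := Eperm_swap R n c y (fun x => sin (t * x + r)) c0.
  rewrite -/N -/T => H.
  have -> : dphi t = - (N^-1 * (N * Eperm R n (fun s => T s * sin (t * T s + r)))).
    rewrite mulKf ?gt_eqF// -mulN1r -EpermZ.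
    by apply: eq_Eperm => s; rewrite mulN1r.
  rewrite -H /phi -mulrN -mulN1r -!EpermZ -!EpermD -EpermB.
  apply: eq_Eperm => s; rewrite -/(T s).
  have -> : \sum_i \sum_j rho s i j = \sum_i \sum_j
      U s i j * (sin (t * (T s + U s i j) + r) - sin (t * T s + r)) -
      t * cos (t * T s + r) * Q s.
    rewrite [X in _ - X]mulr_sumr -sumrB; apply: eq_bigr => i _.
    rewrite [X in _ - X]mulr_sumr -sumrB; apply: eq_bigr => j _.
    by rewrite /rho; ring.
  by rewrite -/U; ring.
rewrite {}E; apply: (le_trans (ler_normB _ _)); apply: lerD.
  apply: (le_trans _ Qe); apply: (le_trans (ler_norm_Eperm _ _ _)).
  apply: le_Eperm => s; rewrite normrN normrM ler_piMl// normrM.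
  by rewrite mulr_ile1// ler_norml cos_geN1 cos_le1.
rewrite normrM gtr0_norm ?invr_gt0// ler_pdivrMl//.
apply: (le_trans (ler_norm_Eperm _ _ _)).
rewrite -[leRHS](Eperm_cst R n); apply: le_Eperm => s.
(* There are [n ^ 2] remainders, each at most [(4 D Y) ^ 3]; dividing by [N = 4 n] gives
   [16 n (D Y) ^ 3]. *)
have -> : N * (16 * n%:R * (D * Y) ^+ 3) =
    \sum_(i < n) \sum_(j < n) (4 * D * Y) ^+ 3.
  by rewrite !sumr_const card_ord /N; ring.
apply: (le_trans (ler_norm_sum _ _ _)); apply: ler_sum => i _.
apply: (le_trans (ler_norm_sum _ _ _)); apply: ler_sum => j _.
rewrite normrM exprS.
have UD : `|U s i j| <= 4 * D * Y by exact: ler_swapdiff.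
apply: ler_pM => //.
rewrite (_ : t * (T s + U s i j) + r = t * T s + r + t * U s i j); last by ring.
apply: (le_trans (sin_taylor1 _ _ _)).
rewrite exprMn -(real_normK (num_real t)) -(real_normK (num_real (U s i j))).
rewrite -[leRHS]mul1r; apply: ler_pM => //; rewrite ?sqr_ge0 ?expr_le1//.
by rewrite ler_pXn2r// nnegrE (le_trans _ UD).
Qed.

End SteinBound.

(** * Trigonometric sums over the roots of unity, and power sums *)

Section RootsOfUnity.
Variable R : realType.

(** The sum telescopes: [2 sin (h / 2) cos x = sin (x + h / 2) - sin (x - h / 2)]. *)
Lemma sum_cos_arith (h a : R) (n : nat) :
  2 * sin (h / 2) * \sum_(i < n) cos (i%:R * h + a) =
  sin (n%:R * h + a - h / 2) - sin (a - h / 2).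
Proof.
elim: n => [|n IH]; first by rewrite big_ord0 mulr0 mul0r add0r subrr.
rewrite big_ord_recr /= mulrDr IH.
have -> : n.+1%:R * h + a - h / 2 = (n%:R * h + a) + h / 2.
  by rewrite -natr1; field.
by rewrite (sinB (n%:R * h + a)) (sinD (n%:R * h + a) (h / 2)); ring.
Qed.

Definition angle (n : nat) (i : 'I_n) : R := 2 * pi * (i.+1)%:R / n%:R.

(** The real form of [\sum_k zeta^(m k) = 0]. The range of [m] makes [sin (pi m / n)] nonzero, so
    that it can be cancelled; the phase [a] lets the sine sums follow as a special case. *)
Lemma sum_cos_angle (n m : nat) (a : R) : (0 < m < n)%N ->
  \sum_i cos (m%:R * angle n i + a) = 0.
Proof.
move=> /andP[m0 mn]; pose h : R := 2 * pi * m%:R / n%:R.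
have n_gt0 : (0 < n)%N by exact: ltn_trans mn.
have n0 : n%:R != 0 :> R by rewrite pnatr_eq0 -lt0n.
have hs : 2 * sin (h / 2) != 0.
  rewrite mulf_neq0// gt_eqF// sin_gt0_pi//.
  rewrite (_ : h / 2 = pi * (m%:R / n%:R)); last by rewrite /h; field.
  rewrite mulr_gt0 ?pi_gt0 ?divr_gt0 ?ltr0n//=.
  by rewrite gtr_pMr ?pi_gt0// ltr_pdivrMr ?mul1r ?ltr_nat// ltr0n.
apply: (mulfI hs); rewrite mulr0.
have E i : m%:R * angle n i + a = i%:R * h + (h + a).
  by rewrite /angle /h -natr1; field.
under eq_bigr do rewrite E.
rewrite sum_cos_arith.
have -> : n%:R * h + (h + a) - h / 2 = (h + a - h / 2) + (pi *+ 2) *+ m.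
  by rewrite /h; field.
by rewrite (periodicn (@sinD2pi R)) subrr.
Qed.

Lemma sum_sin_angle (n m : nat) : (0 < m < n)%N ->
  \sum_i sin (m%:R * angle n i) = 0.
Proof.
move=> mn; rewrite -[RHS](sum_cos_angle n m (- (pi / 2)) mn).
by apply: eq_bigr => i _; rewrite cosBpihalf.
Qed.

Lemma sum_ord_natr (n : nat) : \sum_(i < n) i%:R = n%:R * (n%:R - 1) / 2 :> R.
Proof.
elim: n => [|n IH]; first by rewrite big_ord0 !mul0r.
by rewrite big_ord_recr /= IH -natr1; field.
Qed.

Lemma sum_ord_natr_sqr (n : nat) : \sum_(i < n) i%:R ^+ 2 =
  n%:R * (n%:R - 1) * (2 * n%:R - 1) / 6 :> R.
Proof.
elim: n => [|n IH]; first by rewrite big_ord0 !mul0r.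
by rewrite big_ord_recr /= IH -natr1; field.
Qed.

End RootsOfUnity.

(** * A rate for the characteristic function of [(X_n, Y_n)] at a fixed frequency [(a, b)] *)

Section CharacteristicFunction.
Variables (R : realType) (n : nat) (a b : R).
Hypothesis n2 : (2 < n)%N.

(** All powers of [n] are rewritten as powers of [q = n^(-1/2)], which leaves rational identities
    that [field] can prove. *)
Let q : R := (Num.sqrt n%:R)^-1.
Let K : R := `|a| + `|b|.
Let w (i : 'I_n) : R := a * cos (angle R n i) + b * sin (angle R n i).
(** The fluctuation of [w i ^+ 2] around its mean over the vertices. *)
Let d (i : 'I_n) : R := w i ^+ 2 - (a ^+ 2 + b ^+ 2) / 2.
(** The value [i.+1] minus the mean [(n + 1) / 2] of [1, ..., n]. *)
Let tau (i : 'I_n) : R := i%:R - (n%:R - 1) / 2.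

Let n0 : (0 < n)%N. Proof. by apply: leq_trans n2. Qed.

Let q_gt0 : 0 < q. Proof. by rewrite invr_gt0 sqrtr_gt0 ltr0n. Qed.

Let qX_ge0 k : 0 <= q ^+ k. Proof. by rewrite exprn_ge0// ltW. Qed.

Let nE : n%:R = (q ^+ 2)^-1.
Proof. by rewrite exprVn invrK sqr_sqrtr. Qed.

Let K_ge0 : 0 <= K. Proof. by rewrite addr_ge0. Qed.

Let w_le i : `|w i| <= K.
Proof.
apply: (le_trans (ler_normD _ _)); rewrite !normrM; apply: lerD.
  by rewrite ler_piMr// cos_max.
by rewrite ler_piMr// sin_max.
Qed.

Let w2_le i : w i ^+ 2 <= K ^+ 2.
Proof. by rewrite -real_normK ?num_real// ler_pXn2r// nnegrE. Qed.

Let ab_le : a ^+ 2 + b ^+ 2 <= K ^+ 2.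
Proof.
rewrite -(real_normK (num_real a)) -(real_normK (num_real b)) /K sqrrD.
by rewrite lerD2r lerDl mulrn_wge0// mulr_ge0.
Qed.

Let d_le i : `|d i| <= K ^+ 2.
Proof.
have := w2_le i; have := sqr_ge0 (w i); have := ab_le.
have := sqr_ge0 a; have := sqr_ge0 b.
rewrite /d ler_norml; move: (w i ^+ 2) (K ^+ 2) (a ^+ 2) (b ^+ 2) => *.
by apply/andP; split; lra.
Qed.

Let sum_w : \sum_i w i = 0.
Proof.
rewrite big_split /= -!mulr_sumr.
have n1 : (0 < 1 < n)%N by rewrite (ltn_trans _ n2).
have -> : \sum_(i < n) cos (angle R n i) = 0.
  rewrite -[RHS](sum_cos_angle R n 1 0 n1).
  by apply: eq_bigr => i _; rewrite mul1r addr0.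
have -> : \sum_(i < n) sin (angle R n i) = 0.
  by rewrite -[RHS](sum_sin_angle R n 1 n1); apply: eq_bigr => i _; rewrite mul1r.
by rewrite !mulr0 addr0.
Qed.

(** By the double angle formulas [d] is a combination of [cos] and [sin] of twice the angle, which
    sum to zero because [2 < n]. *)
Let sum_d : \sum_i d i = 0.
Proof.
have dE i : d i = (a ^+ 2 - b ^+ 2) / 2 * cos (2 * angle R n i + 0) +
    a * b * sin (2 * angle R n i).
  rewrite addr0 mulr_natl cos_mulr2n sin_mulr2n /d /w sqrrD !exprMn sin2cos2.
  by field.
under eq_bigr do rewrite dE.
rewrite big_split /= -!mulr_sumr (sum_cos_angle R n 2)// (sum_sin_angle R n 2)//.
by rewrite !mulr0 addr0.
Qed.

Let sum_w2 : \sum_i w i ^+ 2 = n%:R * (a ^+ 2 + b ^+ 2) / 2.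
Proof.
apply/eqP; rewrite -subr_eq0 -[X in _ == X]sum_d /d sumrB sumr_const card_ord.
by apply/eqP; congr (_ - _); field.
Qed.

Let sum_tau : \sum_i tau i = 0.
Proof.
by rewrite /tau sumrB sum_ord_natr sumr_const card_ord; field.
Qed.

Let sum_tau2 : \sum_i tau i ^+ 2 = n%:R * (n%:R ^+ 2 - 1) / 12.
Proof.
have tE i : tau i ^+ 2 = i%:R ^+ 2 - (n%:R - 1) * i%:R + (n%:R - 1) ^+ 2 / 4.
  by rewrite /tau; field.
under eq_bigr do rewrite tE.
rewrite big_split /= sumrB -mulr_sumr sum_ord_natr sum_ord_natr_sqr sumr_const.
by rewrite card_ord; field.
Qed.

Let tau_le i : `|tau i| <= n%:R.
Proof.
have : (i.+1)%:R <= n%:R :> R by rewrite ler_nat.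
have : 0 <= i%:R :> R by [].
rewrite -natr1 /tau ler_norml; move: (i%:R : R) (n%:R : R) => u v *.
by apply/andP; split; lra.
Qed.

Let tau2_le i : `|tau i ^+ 2| <= n%:R ^+ 2.
Proof. by rewrite normrX ler_pXn2r ?nnegrE. Qed.

(** The factor [q ^+ 3] collects [1 / n] from the centroid and [1 / sqrt n] from the rescaling. *)
Let c (i : 'I_n) : R := q ^+ 3 * w i.

Let sum_c : \sum_i c i = 0.
Proof. by rewrite -mulr_sumr sum_w mulr0. Qed.

Let c_le i : `|c i| <= q ^+ 3 * K.
Proof. by rewrite /c normrM (ger0_norm (qX_ge0 3)) ler_wpM2l. Qed.

(** Replacing the values by centred ones changes nothing, as the weights [c] sum to zero. *)
Lemma XY_permstat (s : 'S_n) :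
  a * (XY R s).1 + b * (XY R s).2 = permstat R n c tau s.
Proof.
rewrite /= /ReC /ImC -/q nE invrK.
transitivity (\sum_i c i * ((s i).+1)%:R).
  rewrite !mulr_sumr -big_split /=; apply: eq_bigr => i _.
  by rewrite /c /w /angle nE invrK; ring.
rewrite /permstat.
have -> : \sum_i c i * ((s i).+1)%:R =
    \sum_i (c i * tau (s i) + c i * ((n%:R + 1) / 2)).
  by apply: eq_bigr => i _; rewrite /tau -natr1; field.
by rewrite big_split /= -mulr_suml sum_c mul0r addr0.
Qed.

(** The bound is uniform in [n]; it also provides the tightness used for general test functions. *)
Lemma Eperm_XY_sqr_le :
  Eperm R n (fun s => (a * (XY R s).1 + b * (XY R s).2) ^+ 2) <= 4 * K ^+ 2.
Proof.
under eq_Eperm do rewrite XY_permstat.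
apply: (le_trans (Eperm_permstat2_le R n _ _ _ _ n0 sum_c c_le tau_le)).
by rewrite nE le_eqVlt; apply/orP; left; apply/eqP; field; rewrite gt_eqF.
Qed.

(** Splitting [w i ^+ 2] into its mean and [d i] gives two equal deterministic terms, whose sum
    misses [(a ^+ 2 + b ^+ 2) / 24] by a relative error [q ^+ 4]. What remains is [T ^+ 2] and the
    statistic [V] with weights [d], whose second moment is controlled since [d] sums to zero. *)
Let quadratic_variation_concentrates :
  Eperm R n (fun s => `|(4 * n%:R)^-1 *
      (\sum_i \sum_j swapdiff R n c tau s i j ^+ 2) - (a ^+ 2 + b ^+ 2) / 24|) <=
  q * (1 + 4 * K ^+ 4) / 4 + q ^+ 2 * (4 * K ^+ 2) + q ^+ 4 * K ^+ 2 / 24.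
Proof.
have qn0 : q != 0 by rewrite gt_eqF.
pose V := permstat R n d (fun i => tau i ^+ 2).
pose T := permstat R n c tau.
have QE s : (4 * n%:R)^-1 * (\sum_i \sum_j swapdiff R n c tau s i j ^+ 2)
    - (a ^+ 2 + b ^+ 2) / 24 =
    q ^+ 6 * V s / 2 + q ^+ 2 * T s ^+ 2 - q ^+ 4 * (a ^+ 2 + b ^+ 2) / 24.
  rewrite sum_swapdiff2// -/(T s).
  have -> : \sum_i c i ^+ 2 = q ^+ 6 * (n%:R * (a ^+ 2 + b ^+ 2) / 2).
    rewrite -sum_w2 mulr_sumr; apply: eq_bigr => i _; rewrite /c; ring.
  have -> : permstat R n (fun i => c i ^+ 2) (fun i => tau i ^+ 2) s =
      q ^+ 6 * (V s + (a ^+ 2 + b ^+ 2) / 2 * \sum_i tau i ^+ 2).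
    rewrite (reindex_inj (@perm_inj _ s)) /V /permstat mulr_sumr -big_split mulr_sumr.
    by apply: eq_bigr => i _; rewrite /c /d /=; field.
  rewrite sum_tau2 nE; field.
  by rewrite qn0.
under eq_Eperm do rewrite QE.
have V2 : Eperm R n (fun s => V s ^+ 2) <= 4 * K ^+ 4 * q ^- 10.
  apply: (le_trans (Eperm_permstat2_le R n _ _ _ _ n0 sum_d d_le tau2_le)).
  by rewrite nE le_eqVlt; apply/orP; left; apply/eqP; field.
have T2 : Eperm R n (fun s => T s ^+ 2) <= 4 * K ^+ 2.
  apply: (le_trans _ Eperm_XY_sqr_le); rewrite le_eqVlt; apply/orP; left.
  by apply/eqP/eq_Eperm => s; rewrite XY_permstat.
(* AM-GM: [2 |V| <= q ^- 5 + q ^+ 5 * V ^+ 2] *)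
pose W s := q * 4^-1 + q ^+ 11 / 4 * V s ^+ 2 + q ^+ 2 * T s ^+ 2 +
  q ^+ 4 * K ^+ 2 / 24.
apply: (@le_trans _ _ (Eperm R n W)).
  apply: le_Eperm => s; apply: (le_trans (ler_normB _ _)); apply: lerD; last first.
    have ab0 : 0 <= a ^+ 2 + b ^+ 2 by rewrite addr_ge0 ?sqr_ge0.
    rewrite (ger0_norm (divr_ge0 (mulr_ge0 (qX_ge0 4) ab0) (ler0n R 24))).
    by rewrite ler_wpM2r// ler_wpM2l.
  apply: (le_trans (ler_normD _ _)); apply: lerD; last first.
    by rewrite (ger0_norm (mulr_ge0 (qX_ge0 2) (sqr_ge0 _))).
  rewrite -(real_normK (num_real (V s))).
  have -> : `|q ^+ 6 * V s / 2| = q ^+ 6 / 2 * `|V s|.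
    by rewrite mulrAC normrM (ger0_norm (divr_ge0 (qX_ge0 6) (ler0n R 2))).
  have : 0 <= q * (1 - q ^+ 5 * `|V s|) ^+ 2 by rewrite mulr_ge0 ?sqr_ge0 ?ltW.
  rewrite -subr_ge0 => H.
  rewrite (_ : _ - _ = q * (1 - q ^+ 5 * `|V s|) ^+ 2 / 4); last by field.
  by rewrite divr_ge0// -[leRHS]subr0.
rewrite /W !EpermD !EpermZ !Eperm_cst lerD2r lerD ?ler_wpM2l ?sqr_ge0//.
have -> : q * (1 + 4 * K ^+ 4) / 4 = q * 4^-1 + q ^+ 11 / 4 * (4 * K ^+ 4 * q ^- 10).
  by field.
by rewrite lerD2l ler_wpM2l// divr_ge0.
Qed.

Lemma Eperm_cos_XY (r : R) :
  `|Eperm R n (fun s => cos (a * (XY R s).1 + b * (XY R s).2 + r))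
    - cos r * expR (- ((a ^+ 2 + b ^+ 2) / 24 / 2))| <=
  q * (1 + 4 * K ^+ 4) / 4 + q ^+ 2 * (4 * K ^+ 2) + q ^+ 4 * K ^+ 2 / 24
    + 16 * K ^+ 3 * q.
Proof.
under eq_Eperm do rewrite XY_permstat.
(* With [D = q ^+ 3 * K] and [Y = n] the Taylor error is of order [q]. *)
have -> : 16 * K ^+ 3 * q = 16 * n%:R * (q ^+ 3 * K * n%:R) ^+ 3.
  by rewrite nE; field; rewrite gt_eqF.
apply: Eperm_cos_permstat => //.
by rewrite divr_ge0// addr_ge0 ?sqr_ge0.
Qed.

End CharacteristicFunction.

(** * Passage to the limit in the characteristic function *)

Section CharacteristicFunctionLimit.
Variable R : realType.

Lemma cvg_inv_sqrt : (Num.sqrt n%:R)^-1 @[n --> \oo] --> (0 : R).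
Proof.
have : Num.sqrt (harmonic n) @[n --> \oo] --> Num.sqrt (0 : R).
  by apply: (cvg_comp _ _ (@cvg_harmonic R)); exact: sqrt_continuous.
rewrite sqrtr0 -(cvg_shiftS (fun n => (Num.sqrt n%:R)^-1)).
by apply: cvg_trans; apply: near_eq_cvg; apply: nearW => n; rewrite /= sqrtrV.
Qed.

Lemma cvg_Eperm_cos_XY (a b r : R) :
  Eperm R n (fun s => cos (a * (XY R s).1 + b * (XY R s).2 + r)) @[n --> \oo]
    --> cos r * expR (- ((a ^+ 2 + b ^+ 2) / 24 / 2)).
Proof.
pose q n : R := (Num.sqrt n%:R)^-1.
pose K := `|a| + `|b|.
pose B n := q n * (1 + 4 * K ^+ 4) / 4 + q n ^+ 2 * (4 * K ^+ 2)
  + q n ^+ 4 * K ^+ 2 / 24 + 16 * K ^+ 3 * q n.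
have B0 : B n @[n --> \oo] --> (0 : R).
  (* The error bound is a polynomial in [q n] without constant term, hence tends to 0 with [q n]. *)
  pose p : {poly R} := (((1 + 4 * K ^+ 4) / 4) *: 'X + (4 * K ^+ 2) *: 'X^2
    + (K ^+ 2 / 24) *: 'X^4 + (16 * K ^+ 3) *: 'X)%R.
  have BE n : B n = p.[q n].
    by rewrite /B /p !(hornerD, hornerZ, hornerXn, hornerX); field.
  have : p.[q n] @[n --> \oo] --> p.[0].
    by apply: (cvg_comp _ _ cvg_inv_sqrt); exact: continuous_horner.
  rewrite {2}/p !(hornerD, hornerZ, hornerXn, hornerX) !expr0n/= !mulr0 !addr0.

  by apply: cvg_trans; apply: near_eq_cvg; apply: nearW => n.
apply/cvgrPdist_le => e e0.
have /cvgrPdist_le/(_ _ e0) := B0.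
move=> Be; near=> n; have n2 : (2 < n)%N by near: n; exact: nbhs_infty_gt.
rewrite distrC.
apply: (le_trans (Eperm_cos_XY R n a b n2 r)).
have : `|0 - B n| <= e by near: n.
by rewrite sub0r normrN; apply: le_trans; exact: ler_norm.
Unshelve. all: by end_near. Qed.

End CharacteristicFunctionLimit.

(** * One-dimensional Gaussian integrals: Stein's identity and the characteristic function *)

Section GaussianIntegrals.
Variables (R : realType) (s : R).
Hypothesis s_gt0 : 0 < s.
Local Notation mu := (@lebesgue_measure R).
Local Notation rho := (normal_pdf 0 s).

Let s_neq0 : s != 0. Proof. by rewrite gt_eqF. Qed.

Let rhoE x : rho x = normal_peak s * expR (- x ^+ 2 / (2 * s ^+ 2)).
Proof. by rewrite normal_pdfE// /normal_fun subr0 mulr_natl. Qed.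

Let x1 (x : R) : `|x| <= 1 + x ^+ 2.
Proof.
rewrite -real_normK ?num_real//.
have := sqr_ge0 (`|x| - 1); have := normr_ge0 x.
by move: `|x| => u u0 H; nra.
Qed.

Definition gauss_tail_const : R := (1 + 8 * s ^+ 2) * (normal_peak s / normal_peak (2 * s)).

Lemma gauss_tail_const_ge0 : 0 <= gauss_tail_const.
Proof.
apply: mulr_ge0; last by apply: divr_ge0; exact: normal_peak_ge0.
by apply: addr_ge0 => //; apply: mulr_ge0 => //; exact: sqr_ge0.
Qed.

(** The density of standard deviation [2 * s] absorbs a quadratic factor: the quotient of the
    exponentials is [expR (- u)] with [u = 3 x ^+ 2 / (8 s ^+ 2)], and [1 + u <= expR u]. This
    yields both integrability and decay at infinity. *)
Lemma normal_pdf_tail x : (1 + x ^+ 2) * rho x <= gauss_tail_const * normal_pdf 0 (2 * s) x.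
Proof.
have s2 : 2 * s != 0 by rewrite mulf_neq0.
have p2 : normal_peak (2 * s) != 0 by rewrite gt_eqF ?normal_peak_gt0.
rewrite rhoE normal_pdfE// /normal_fun subr0 /gauss_tail_const.
set E := expR (- x ^+ 2 / ((2 * s) ^+ 2 *+ 2)).
have -> : expR (- x ^+ 2 / (2 * s ^+ 2)) = E * expR (- (3 * x ^+ 2 / (8 * s ^+ 2))).
  by rewrite -expRD; congr expR; field.
have -> : (1 + 8 * s ^+ 2) * (normal_peak s / normal_peak (2 * s)) *
    (normal_peak (2 * s) * E) = normal_peak s * E * (1 + 8 * s ^+ 2) by field.
set e := expR (- _).
have -> : (1 + x ^+ 2) * (normal_peak s * (E * e)) =
  normal_peak s * E * ((1 + x ^+ 2) * e) by ring.
rewrite ler_wpM2l ?mulr_ge0 ?normal_peak_ge0 ?expR_ge0// {}/e.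
rewrite expRN ler_pdivrMr ?expR_gt0//.
apply: (@le_trans _ _ ((1 + 8 * s ^+ 2) * (1 + 3 * x ^+ 2 / (8 * s ^+ 2)))).
  rewrite -subr_ge0.
  have -> : (1 + 8 * s ^+ 2) * (1 + 3 * x ^+ 2 / (8 * s ^+ 2)) - (1 + x ^+ 2) =
    3 * x ^+ 2 / (8 * s ^+ 2) + 8 * s ^+ 2 + 2 * x ^+ 2 by field.
  have x2 := sqr_ge0 x; have s2' := sqr_ge0 s.
  by apply: addr_ge0; [apply: addr_ge0; [apply: divr_ge0|]|]; apply: mulr_ge0.
rewrite ler_wpM2l ?expR_ge1Dx//.
by apply: addr_ge0 => //; apply: mulr_ge0 => //; exact: sqr_ge0.
Qed.

Lemma integrable_poly2_normal_pdf :
  mu.-integrable setT (fun x => ((1 + x ^+ 2) * rho x)%:E).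
Proof.
apply: (@le_integrable _ _ _ mu _ measurableT _
  (fun x => (gauss_tail_const%:E * (normal_pdf 0 (2 * s) x)%:E)%E)); last first.
- by apply: integrableZl => //; exact: integrable_normal_pdf.
- move=> x _; rewrite -EFinM !abse_EFin lee_fin ger0_norm; last first.
    by rewrite mulr_ge0 ?normal_pdf_ge0// addr_ge0 ?sqr_ge0.
  by apply: (le_trans (normal_pdf_tail x)); exact: ler_norm.
- apply/measurable_EFinP; apply: measurable_funM; last exact: measurable_normal_pdf.
  by apply: measurable_funD => //; exact: measurable_funX.
Qed.

Lemma integrable_normal_pdfM (h : R -> R) (C : R) : measurable_fun setT h ->
  (forall x, `|h x| <= C * (1 + x ^+ 2)) ->
  mu.-integrable setT (fun x => (h x * rho x)%:E).
Proof.
move=> mh hC; apply: (@le_integrable _ _ _ mu _ measurableT _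
  (fun x => (C%:E * ((1 + x ^+ 2) * rho x)%:E)%E)); last first.
- by apply: integrableZl => //; exact: integrable_poly2_normal_pdf.
- move=> x _; rewrite -EFinM !abse_EFin lee_fin mulrA !normrM.
  rewrite ler_wpM2r// (le_trans (hC x))// -normrM ler_norm//.
- by apply/measurable_EFinP; apply: measurable_funM => //; exact: measurable_normal_pdf.
Qed.

Lemma is_derive_normal_pdf (x : R) : is_derive x (1:R) rho (- (x / s ^+ 2) * rho x).
Proof.
have h : is_derive x (1:R) (fun x : R => - (2 * s ^+ 2)^-1 * x ^+ 2) (- (x / s ^+ 2)).
  apply: (@is_derive_ext _ ((- (2 * s ^+ 2)^-1) \*: (id ^+ 2))) => [u|] //.
  by apply: is_derive_eq; rewrite /GRing.scale/= expr1 mulr1; field.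
apply: (@is_derive_ext _
  (normal_peak s \*: (expR \o (fun x : R => - (2 * s ^+ 2)^-1 * x ^+ 2)))) => [u|].
  by rewrite /= rhoE /GRing.scale/=; congr (_ * expR _); field.
apply: is_derive_eq; rewrite /GRing.scale/= rhoE.
have -> : - (2 * s ^+ 2)^-1 * x ^+ 2 = - x ^+ 2 / (2 * s ^+ 2) by field.
by ring.
Qed.

(* Integration by parts: the derivative of [s ^+ 2 * h * rho] integrates to 0. *)
Lemma normal_stein (h dh : R -> R) (C : R) :
  (forall x : R, is_derive x (1:R) h (dh x)) -> continuous dh ->
  (forall x, `|h x| <= C) -> (forall x, `|dh x| <= C) ->
  \int[mu]_x (x * h x * rho x) = s ^+ 2 * \int[mu]_x (dh x * rho x).
Proof.
move=> hdh cdh hC dhC.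
have C0 : 0 <= C by rewrite (le_trans _ (hC 0)).
have ch : continuous h.
  by move=> x; apply/differentiable_continuous/derivable1_diffP; exact: ex_derive.
have i1 : mu.-integrable setT (fun x => (x * h x * rho x)%:E).
  apply: (integrable_normal_pdfM _ C).
    by apply: measurable_funM => //; exact: continuous_measurable_fun.
  by move=> x; rewrite normrM mulrC; apply: ler_pM.
have i2 : mu.-integrable setT (fun x => (dh x * rho x)%:E).
  apply: (integrable_normal_pdfM _ C); first exact: continuous_measurable_fun.
  by move=> x; rewrite (le_trans (dhC x))// ler_peMr// lerDl sqr_ge0.
pose F x := s ^+ 2 * (h x * rho x).
pose f x := s ^+ 2 * (dh x * rho x) - x * h x * rho x.
have dF x : is_derive x (1:R) F (f x).
  apply: (@is_derive_ext _ ((s ^+ 2) \*: (h * rho))) => [u|] //.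
  have d1 := hdh x; have d2 := is_derive_normal_pdf x.
  by apply: is_derive_eq; rewrite /GRing.scale/= /f; field.
have cF : continuous F.
  by move=> x; apply/differentiable_continuous/derivable1_diffP; exact: ex_derive.
have crho : continuous rho by exact: continuous_normal_pdf.
have cf : continuous f.
  move=> x; apply: cvgB.
    by apply: cvgM; [exact: cvg_cst|apply: cvgM; [exact: cdh|exact: crho]].
  by apply: cvgM; [apply: cvgM; [exact: cvg_id|exact: ch]|exact: crho].
have intf : mu.-integrable setT (EFin \o f).
  have -> : EFin \o f = (fun x => (s ^+ 2)%:E * (dh x * rho x)%:E - (x * h x * rho x)%:E)%E.
    by apply/funext => x /=; rewrite /f EFinB EFinM.
  apply: integrableB => //.
  by apply: (@integrableZl _ _ _ mu _ measurableT (s ^+ 2) _ i2).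
suff: \int[mu]_x (f x) = 0.
  rewrite /f RintegralB//; last first.
    by apply: (@integrableZl _ _ _ mu _ measurableT (s ^+ 2) _ i2).
  by rewrite RintegralZl// => /eqP; rewrite subr_eq0 => /eqP ->.
(* By dominated convergence the integral of [f] is the limit of its integrals over
   [[- (n + 1), n + 1]], which are boundary values of the primitive [F]. *)
pose A (n : nat) : set R := `[- n.+1%:R, n.+1%:R]%classic.
pose fn n : R -> \bar R := (EFin \o f) \_ (A n).
have mfn n : measurable_fun setT (fn n).
  apply/(measurable_restrictT _ _).1; first exact: measurable_itv.
  by apply: measurable_funTS; apply/measurable_EFinP; exact: continuous_measurable_fun.
have fnf x : fn ^~ x @ \oo --> (f x)%:E.
  apply: cvg_near_cst; near=> n; rewrite /fn patchE ifT//.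
  rewrite inE /A/= in_itv/= -ler_norml.
  near: n; exists (Num.truncn `|x|) => // n /= xn.
  by rewrite ltW// (lt_le_trans (truncnS_gt _))// ler_nat.
have fn_le n x : (`|fn n x| <= `|(f x)%:E|)%E.
  by rewrite /fn patchE; case: ifP => // _; rewrite abse0.
have ae1 : {ae mu, forall x, setT x -> fn ^~ x @ \oo --> (EFin \o f) x}.
  by apply: aeW => x _; exact: fnf.
have ae2 : {ae mu, forall x n, setT x -> (`|fn n x| <= `|(EFin \o f) x|)%E}.
  by apply: aeW => x n _; exact: fn_le.
have [_ _] := @dominated_convergence _ _ _ mu setT measurableT fn (EFin \o f)
  _ mfn (measurable_int _ intf) ae1 (integrable_abse intf) ae2.
have -> : (fun n => \int[mu]_x fn n x)%E = (fun n => (F n.+1%:R - F (- n.+1%:R))%:E).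
  apply/funext => n; rewrite /fn -integral_mkcond EFinB.
  apply: (continuous_FTC2 (F := F)).
  - by rewrite gtrN.
  - exact: continuous_subspaceT.
  - split; last 2 first.
    + by apply: cvg_at_right_filter; exact: cF.
    + by apply: cvg_at_left_filter; exact: cF.
    by move=> x _; exact: ex_derive.
  - by move=> x _; rewrite derive1E; exact: derive_val.
have F0 : (F n.+1%:R - F (- n.+1%:R)) @[n --> \oo] --> (0 : R).
  (* The tail bound makes [|x| * |F x|] bounded, so the boundary terms are [O(1 / n)]. *)
  pose D := s ^+ 2 * (C * (gauss_tail_const * normal_peak (2 * s))).
  have FD x : `|x| * `|F x| <= D.
    have rho0 : 0 <= rho x by exact: normal_pdf_ge0.
    have -> : `|x| * `|F x| = s ^+ 2 * (`|h x| * (`|x| * rho x)).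
      rewrite /F (normrM (s ^+ 2)) (normrM (h x)) (ger0_norm (sqr_ge0 s)).
      by rewrite (ger0_norm rho0); ring.
    rewrite /D ler_wpM2l ?sqr_ge0//; apply: ler_pM => //.
      exact: mulr_ge0.
    apply: (@le_trans _ _ ((1 + x ^+ 2) * rho x)).
      by rewrite ler_wpM2r ?normal_pdf_ge0.
    apply: (le_trans (normal_pdf_tail x)); rewrite ler_wpM2l ?gauss_tail_const_ge0//.
    by rewrite normal_pdf_ub ?mulf_neq0.
  have FD' (n : nat) (x : R) : `|x| = n.+1%:R -> `|F x| <= D * harmonic n.
    by move=> xn; rewrite /harmonic/= ler_pdivlMr// mulrC -xn.
  apply: norm_cvg0.
  apply: (@squeeze_cvgr _ _ _ _ (cst 0) (fun n => 2 * D * harmonic n)).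
  - apply: nearW => n; rewrite normr_ge0/= (le_trans (ler_normB _ _))//.
    by rewrite (_ : 2 * D * harmonic n = D * harmonic n + D * harmonic n);
      [apply: lerD; apply: FD'; rewrite ?normrN normr_nat|ring].
  - exact: cvg_cst.
  - rewrite -[X in _ --> X](mulr0 (2 * D)); apply: cvgM; first exact: cvg_cst.
    exact: cvg_harmonic.
have F0E : (F n.+1%:R - F (- n.+1%:R))%:E @[n --> \oo] --> 0%:E.
  by apply: cvg_EFin; [exact: nearW|exact: F0].
move=> cv; have E := cvg_unique _ cv F0E.
by rewrite /Rintegral [X in fine X]E.
Unshelve. all: by end_near. Qed.

(** The same differential equation as for permutations, now exact: differentiating under the
    integral in the scale [t] and applying [normal_stein] to a sine gives
    [phi' = - s ^+ 2 b ^+ 2 t phi]. *)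
Lemma normal_cos (b r : R) :
  \int[mu]_x (cos (b * x + r) * rho x) = cos r * expR (- (s ^+ 2 * b ^+ 2 / 2)).
Proof.
have ccos (t : R) : continuous (fun x : R => cos (t * (b * x) + r)).
  move=> x; apply: (cvg_comp _ cos); last exact: continuous_cos.
  apply: cvgD; last exact: cvg_cst.
  apply: cvgM; first exact: cvg_cst.
  by apply: cvgM; [exact: cvg_cst|exact: cvg_id].
have csin (t : R) : continuous (fun x : R => sin (t * (b * x) + r)).
  move=> x; apply: (cvg_comp _ sin); last exact: continuous_sin.
  apply: cvgD; last exact: cvg_cst.
  apply: cvgM; first exact: cvg_cst.
  by apply: cvgM; [exact: cvg_cst|exact: cvg_id].
have icos (t : R) : mu.-integrable setT (fun x => (cos (t * (b * x) + r) * rho x)%:E).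
  apply: (integrable_normal_pdfM _ 1); first exact: continuous_measurable_fun.
  by move=> x; rewrite mul1r (le_trans (cos_max _))// lerDl sqr_ge0.
pose phi t := \int[mu]_x (cos (t * (b * x) + r) * rho x).
pose dphi t := \int[mu]_x (- (b * x * sin (t * (b * x) + r)) * rho x).
have phi'E (t : R) : is_derive t (1:R) phi (dphi t).
  pose f (t x : R) := cos (t * (b * x) + r) * rho x.
  have df (t' x : R) : is_derive t' (1:R) (f ^~ x)
      (- (b * x * sin (t' * (b * x) + r)) * rho x).
    apply: (@is_derive_ext _ (rho x \*: (fun t => cos (t * (b * x) + r)))) => [u|].
      by rewrite /f /= /GRing.scale/=; ring.
    have h := is_derive_cos_affine R t' (b * x) r.
    by apply: is_derive_eq; rewrite /GRing.scale/=; ring.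
  (* An integrable majorant of the [t]-derivative, independent of [t]. *)
  pose G x := `|b| * (1 + x ^+ 2) * rho x.
  have tI : `]t - 1, t + 1[%classic t by rewrite /= in_itv/= ltrBlDr ltrDl ltr01.
  have if' (t' : R) : `]t - 1, t + 1[%classic t' -> mu.-integrable setT (EFin \o f t').
    by move=> _; exact: icos.
  have derf (t' x : R) : `]t - 1, t + 1[%classic t' -> setT x -> derivable (f ^~ x) t' 1.
    by move=> _ _; exact: ex_derive.
  have G0 x : 0 <= G x.
    apply: mulr_ge0; last exact: normal_pdf_ge0.
    by apply: mulr_ge0 => //; apply: addr_ge0 => //; exact: sqr_ge0.
  have iG : mu.-integrable setT (EFin \o G).
    apply: (integrable_normal_pdfM _ `|b|).
      by apply: measurable_funM => //; apply: measurable_funD => //; exact: measurable_funX.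
    by move=> x; rewrite normrM normr_id (ger0_norm (addr_ge0 ler01 (sqr_ge0 x))).
  have fG (t' x : R) : `]t - 1, t + 1[%classic t' -> setT x -> `|partial1of2 f t' x| <= G x.
    move=> _ _; rewrite partial1of2E derive_val normrM (ger0_norm (normal_pdf_ge0 _ _ _)).
    rewrite /G ler_wpM2r ?normal_pdf_ge0// normrN -mulrA normrM ler_wpM2l//.
    rewrite normrM; apply: (@le_trans _ _ `|x|); first by rewrite ler_piMr// sin_max.
    exact: x1.
  have H1 := derivable_under_integral measurableT tI if' derf G0 iG fG.
  have H2 := differentiation_under_integral measurableT tI if' derf G0 iG fG.
  apply: DeriveDef; first exact: H1.
  rewrite -derive1E H2; apply: eq_Rintegral => x _.
  by rewrite partial1of2E derive_val.
have phi1 : \int[mu]_x (cos (b * x + r) * rho x) = phi 1.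
  by apply: eq_Rintegral => x _; rewrite mul1r.
have phi0 : phi 0 = cos r.
  rewrite /phi; under eq_Rintegral do rewrite mul0r add0r.
  rewrite RintegralZl//; last exact: integrable_normal_pdf.
  by rewrite /Rintegral integral_normal_pdf mulr1.
rewrite phi1 -phi0; apply/eqP; rewrite -subr_eq0 -normr_le0.
apply: (gronwall_gauss R phi dphi (s ^+ 2 * b ^+ 2) 0 _ phi'E).
  by rewrite mulr_ge0 ?sqr_ge0.
move=> t _; rewrite normr_le0; apply/eqP.
pose dh (x : R) := t * b * cos (t * b * x + r).
have hdh (x : R) : is_derive x (1:R) (fun x => sin (t * b * x + r)) (dh x).
  have h : is_derive x (1:R) (fun x : R => t * b * x + r) (t * b).
    apply: (@is_derive_ext _ (((t * b) \*: id) + cst r)) => [u|] //.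
    by apply: is_derive_eq; rewrite addr0 /GRing.scale/= mulr1.
  apply: (@is_derive_eq _ _ _ (sin \o (fun x => t * b * x + r))).
  by rewrite /dh /=; ring.
have cdh : continuous dh.
  move=> x; apply: cvgM; first exact: cvg_cst.
  by under eq_fun do rewrite -mulrA; have := ccos t x; rewrite /continuous_at -mulrA.
have hC (x : R) : `|sin (t * b * x + r)| <= 1 + `|t * b|.
  by rewrite (le_trans (sin_max _))// lerDl.
have dhC (x : R) : `|dh x| <= 1 + `|t * b|.
  by rewrite normrM (@le_trans _ _ `|t * b|) ?lerDr// ler_piMr// cos_max.
have := normal_stein _ _ (1 + `|t * b|) hdh cdh hC dhC.
have -> : \int[mu]_x (dh x * rho x) = t * b * phi t.
  rewrite -RintegralZl//.
    by apply: eq_Rintegral => x _; rewrite /dh -!mulrA.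
  by have := icos t; rewrite /comp /=; under eq_fun do rewrite mulrA.
have -> : dphi t = - b * \int[mu]_x (x * sin (t * b * x + r) * rho x).
  rewrite -RintegralZl//.
    by apply: eq_Rintegral => x _; rewrite -(mulrA t); ring.
  apply: (integrable_normal_pdfM _ 1).
    apply: measurable_funM => //.
    by under eq_fun do rewrite -mulrA; exact: continuous_measurable_fun.
  move=> x; rewrite mul1r; apply: (@le_trans _ _ `|x|); last exact: x1.
  by rewrite normrM ler_piMr// sin_max.
by move=> ->; ring.
Qed.

End GaussianIntegrals.

(** * The isotropic planar Gaussian as a product of two normal laws *)

Section BivariateGaussian.
Variables (R : realType) (v : R).
Hypothesis v_gt0 : 0 < v.
Local Notation mu := (@lebesgue_measure R).
Local Notation mu2 := (@lebesgue_measure R \x @lebesgue_measure R)%E.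
Local Notation s := (Num.sqrt v).
Local Notation rho := (normal_pdf 0 s).

Let s_gt0 : 0 < s. Proof. by rewrite sqrtr_gt0. Qed.

Let s2E : s ^+ 2 = v. Proof. by rewrite sqr_sqrtr// ltW. Qed.

Lemma gauss2_densityE (z : R * R) : gauss2_density v z = rho z.1 * rho z.2.
Proof.
have v0 : v != 0 by rewrite gt_eqF.
rewrite normal_pdfE ?gt_eqF// /normal_fun !subr0 /normal_peak s2E.
have p0 : 0 < v * pi *+ 2 by rewrite pmulrn_lgt0// mulr_gt0// pi_gt0.
have pi0 : pi != 0 :> R by rewrite gt_eqF// pi_gt0.
set c := (Num.sqrt (v * pi *+ 2))^-1.
have cE : c * c = (2 * pi * v)^-1.
  by rewrite -expr2 exprVn sqr_sqrtr ?ltW//; congr (_^-1); ring.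
rewrite /gauss2_density -cE mulrACA -expRD; congr (_ * expR _).
by field.
Qed.

Let mz1 : measurable_fun [set: R * R] (fun z => z.1). Proof. exact: measurable_fst. Qed.
Let mz2 : measurable_fun [set: R * R] (fun z => z.2). Proof. exact: measurable_snd. Qed.

Lemma measurable_gauss2_density : measurable_fun setT (gauss2_density v).
Proof.
rewrite (_ : gauss2_density v = fun z => rho z.1 * rho z.2); last first.
  by apply/funext => z; rewrite gauss2_densityE.
by apply: measurable_funM; apply: measurableT_comp => //; exact: measurable_normal_pdf.
Qed.

Lemma gauss2_density_ge0 (z : R * R) : 0 <= gauss2_density v z.
Proof. by rewrite gauss2_densityE mulr_ge0 ?normal_pdf_ge0. Qed.

(** The majorant is a product of functions of one variable, so its iterated integral factors. *)
Lemma integrable_gauss2 (h : R * R -> R) (C : R) : measurable_fun setT h ->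
  (forall z, `|h z| <= C * ((1 + z.1 ^+ 2) * (1 + z.2 ^+ 2))) ->
  mu2.-integrable setT (fun z => (h z * gauss2_density v z)%:E).
Proof.
move=> mh hC.
pose p x := (1 + x ^+ 2) * rho x.
have p0 x : 0 <= p x by rewrite mulr_ge0 ?normal_pdf_ge0// addr_ge0 ?sqr_ge0.
have mp : measurable_fun setT p.
  apply: measurable_funM; last exact: measurable_normal_pdf.
  by apply: measurable_funD => //; exact: measurable_funX.
have ip : mu.-integrable setT (EFin \o p) by exact: integrable_poly2_normal_pdf.
have ipp : mu2.-integrable setT (fun z => (p z.1 * p z.2)%:E).
  apply/integrable12ltyP.
    by apply/measurable_EFinP; apply: measurable_funM; apply: measurableT_comp.
  have -> : (fun x => \int[mu]_y `|(p (x, y).1 * p (x, y).2)%:E|)%E =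
      (fun x => (p x)%:E * \int[mu]_y (p y)%:E)%E.
    apply/funext => x; rewrite -integralZl//; apply: eq_integral => y _.
    by rewrite -EFinM abse_EFin ger0_norm// mulr_ge0.
  have /fineK <- : (\int[mu]_y (p y)%:E \is a fin_num)%E by exact: integrable_fin_num.
  rewrite integralZr//.
  apply: lte_mul_pinfty; rewrite ?integral_ge0 ?ltry//.
    by move=> *; rewrite lee_fin.
  exact: integrable_fin_num.
apply: (@le_integrable _ _ _ mu2 _ measurableT _
  (fun z => (C%:E * (p z.1 * p z.2)%:E)%E)); last first.
- exact: integrableZl.
- move=> z _; rewrite -EFinM !abse_EFin lee_fin (normrM (h z)).
  rewrite (ger0_norm (gauss2_density_ge0 z)) gauss2_densityE.
  apply: le_trans (ler_norm _).
  rewrite (_ : _ * (p z.1 * _) = C * ((1 + z.1 ^+ 2) * (1 + z.2 ^+ 2)) * (rho z.1 * rho z.2)).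
    by rewrite ler_wpM2r// mulr_ge0 ?normal_pdf_ge0.
  by rewrite /p; ring.
- apply/measurable_EFinP; apply: measurable_funM => //.
  exact: measurable_gauss2_density.
Qed.

Lemma integrable_bounded_gauss2 (h : R * R -> R) (C : R) : measurable_fun setT h ->
  (forall z, `|h z| <= C) ->
  mu2.-integrable setT (fun z => (h z * gauss2_density v z)%:E).
Proof.
move=> mh hC; apply: (integrable_gauss2 _ C) => // z.
have C0 : 0 <= C by rewrite (le_trans _ (hC z)).
rewrite (le_trans (hC z))// ler_peMr// mulrDl mul1r -addrA lerDl.
by rewrite addr_ge0 ?sqr_ge0// mulr_ge0 ?sqr_ge0// addr_ge0 ?sqr_ge0.
Qed.

Lemma measurable_cos_affine2 (a b r : R) :
  measurable_fun setT (fun z : R * R => cos (a * z.1 + b * z.2 + r)).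
Proof.
apply: (measurableT_comp (continuous_measurable_fun (@continuous_cos R))).
by apply: measurable_funD => //; apply: measurable_funD; exact: measurable_funM.
Qed.

(** Fubini and two uses of [normal_cos]: first in [y] with phase [a * x + r], then in [x] with phase
    [r]. *)
Lemma gauss2_cos (a b r : R) :
  \int[mu2]_z (cos (a * z.1 + b * z.2 + r) * gauss2_density v z) =
  cos r * expR (- ((a ^+ 2 + b ^+ 2) * v / 2)).
Proof.
pose f z := (cos (a * z.1 + b * z.2 + r) * gauss2_density v z)%:E.
have intf : mu2.-integrable setT f.
  apply: (integrable_bounded_gauss2 _ 1); first exact: measurable_cos_affine2.
  by move=> z; exact: cos_max.
rewrite /Rintegral -/f -(integral12_prod_meas1 intf) /fubini_F.
pose e := expR (- (s ^+ 2 * b ^+ 2 / 2)).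
have E x : (\int[mu]_y f (x, y))%E = (cos (a * x + r) * rho x * e)%:E.
  have -> : (fun y => f (x, y)) =
      (fun y => (rho x)%:E * (cos (b * y + (a * x + r)) * rho y)%:E)%E.
    apply/funext => y; rewrite /f gauss2_densityE /= -EFinM; congr EFin.
    by rewrite (_ : a * x + b * y + r = b * y + (a * x + r)); ring.
  have int1 : mu.-integrable setT (fun y => (cos (b * y + (a * x + r)) * rho y)%:E).
    apply: (integrable_normal_pdfM R s s_gt0 _ 1).
      apply: (measurableT_comp (continuous_measurable_fun (@continuous_cos R))).
      by apply: measurable_funD => //; exact: measurable_funM.
    by move=> y; rewrite mul1r (le_trans (cos_max _))// lerDl sqr_ge0.
  rewrite integralZl// -[X in (_ * X)%E]fineK ?integrable_fin_num//.
  rewrite -/(Rintegral mu setT (fun y => cos (b * y + (a * x + r)) * rho y)).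
  by rewrite normal_cos// -EFinM /e; congr EFin; ring.
under eq_integral do rewrite E.
rewrite -/(Rintegral mu setT (fun x => cos (a * x + r) * rho x * e)).
rewrite RintegralZr//; last first.
  apply: (integrable_normal_pdfM R s s_gt0 _ 1).
    apply: (measurableT_comp (continuous_measurable_fun (@continuous_cos R))).
    by apply: measurable_funD => //; exact: measurable_funM.
  by move=> y; rewrite mul1r (le_trans (cos_max _))// lerDl sqr_ge0.
rewrite normal_cos// /e -(mulrA (cos r)) -expRD s2E; congr (_ * expR _).
by field.
Qed.

Lemma gauss2_mass : \int[mu2]_z (gauss2_density v z) = 1.
Proof.
have := gauss2_cos 0 0 0.
rewrite cos0 mul1r expr0n/= addr0 mul0r mul0r oppr0 expR0 => <-.
by apply: eq_Rintegral => z _; rewrite !mul0r !addr0 cos0 mul1r.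
Qed.

End BivariateGaussian.

(** * A class of test functions, stable under trigonometric operations, for which the limit holds *)

Section TestFunctions.
Variable R : realType.
Local Notation mu2 := (@lebesgue_measure R \x @lebesgue_measure R)%E.
Local Notation dens := (gauss2_density (1 / 24)).
Implicit Types F G h : R * R -> R.

Let v_gt0 : 0 < 1 / 24 :> R. Proof. by rewrite divr_gt0. Qed.

Definition gauss_mean h : R := \int[mu2]_z (h z * dens z).

(** Measurability and boundedness are carried along because linearity of the Gaussian integral
    requires integrability. *)
Definition clt_holds h : Prop := [/\ measurable_fun setT h,
  exists C, forall z, `|h z| <= C &
  Eperm R n (fun s => h (XY R s)) @[n --> \oo] --> gauss_mean h].

Lemma clt_holds_cos (a b r : R) :
  clt_holds (fun z => cos (a * z.1 + b * z.2 + r)).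
Proof.
split; first exact: measurable_cos_affine2.
  by exists 1 => z; exact: cos_max.
rewrite /gauss_mean gauss2_cos//.
rewrite (_ : (a ^+ 2 + b ^+ 2) * (1 / 24) / 2 = (a ^+ 2 + b ^+ 2) / 24 / 2); last by field.
exact: cvg_Eperm_cos_XY.
Qed.

Lemma clt_holdsD F G : clt_holds F -> clt_holds G -> clt_holds (fun z => F z + G z).
Proof.
move=> [mF [A FA] cF] [mG [B GB] cG]; split; first exact: measurable_funD.
  by exists (A + B) => z; rewrite (le_trans (ler_normD _ _))// lerD.
rewrite /gauss_mean; under eq_Rintegral do rewrite mulrDl.
rewrite RintegralD//; try exact: (integrable_bounded_gauss2 _ _ v_gt0 _ _ _ FA);
  try exact: (integrable_bounded_gauss2 _ _ v_gt0 _ _ _ GB).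
apply: cvg_trans (cvgD cF cG); apply: near_eq_cvg; apply: nearW => n.
by rewrite EpermD.
Qed.

Lemma clt_holdsZ (k : R) F : clt_holds F -> clt_holds (fun z => k * F z).
Proof.
move=> [mF [A FA] cF]; split; first exact: measurable_funM.
  by exists (`|k| * A) => z; rewrite normrM ler_wpM2l.
rewrite /gauss_mean; under eq_Rintegral do rewrite -mulrA.
rewrite RintegralZl//; last exact: (integrable_bounded_gauss2 _ _ v_gt0 _ _ _ FA).
apply: cvg_trans (cvgM (cvg_cst k) cF); apply: near_eq_cvg; apply: nearW => n.
by rewrite EpermZ.
Qed.

(* Modulating by cosines makes the class stable under products with sines. *)
Definition clt_modulated F : Prop := forall a b r : R,
  clt_holds (fun z => F z * cos (a * z.1 + b * z.2 + r)).

Lemma clt_modulated_holds F : clt_modulated F -> clt_holds F.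
Proof.
move=> /(_ 0 0 0); congr clt_holds; apply/funext => z.
by rewrite !mul0r !addr0 cos0 mulr1.
Qed.

Lemma clt_modulated_cst (k : R) : clt_modulated (fun=> k).
Proof. by move=> a b r; apply: clt_holdsZ; exact: clt_holds_cos. Qed.

Lemma clt_modulatedD F G :
  clt_modulated F -> clt_modulated G -> clt_modulated (fun z => F z + G z).
Proof.
move=> cF cG a b r; under eq_fun do rewrite mulrDl.
exact: clt_holdsD.
Qed.

Lemma clt_modulatedZ (k : R) F :
  clt_modulated F -> clt_modulated (fun z => k * F z).
Proof.
move=> cF a b r; under eq_fun do rewrite -mulrA.
exact: clt_holdsZ.
Qed.

(** The product-to-sum formula turns the sine times the modulating cosine into two cosines with
    shifted frequencies and phase [r - pi / 2]. *)
Lemma clt_modulated_sin (c d : R) F : clt_modulated F ->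
  clt_modulated (fun z => sin (c * z.1 + d * z.2) * F z).
Proof.
move=> cF a b r.
have -> : (fun z : R * R => sin (c * z.1 + d * z.2) * F z * cos (a * z.1 + b * z.2 + r)) =
  (fun z => 2^-1 * (F z * cos ((a + c) * z.1 + (b + d) * z.2 + (r - pi / 2))) +
     (- 2^-1) * (F z * cos ((a - c) * z.1 + (b - d) * z.2 + (r - pi / 2)))).
  apply/funext => z; rewrite !addrA !cosBpihalf.
  rewrite (_ : (a + c) * z.1 + (b + d) * z.2 + r =
    (a * z.1 + b * z.2 + r) + (c * z.1 + d * z.2)); last by ring.
  rewrite (_ : (a - c) * z.1 + (b - d) * z.2 + r =
    (a * z.1 + b * z.2 + r) - (c * z.1 + d * z.2)); last by ring.
  rewrite (sinD (a * z.1 + b * z.2 + r)) (sinB (a * z.1 + b * z.2 + r)).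
  by field.
by apply: clt_holdsD; apply: clt_holdsZ; exact: cF.
Qed.

End TestFunctions.

(** * Bernstein operators in one and two variables *)

Section Bernstein.
Variable R : realType.
Implicit Types (u v w e C : R) (m : nat) (f g : nat -> R).

(* [bernstein u m f] is the mean of [f] under the binomial law of parameters
   [m] and [u], i.e. the Bernstein polynomial with values [f i] at the nodes
   [i / m]; conditioning on the first trial gives this recursion. *)
Fixpoint bernstein u m f : R :=
  if m is m'.+1 then
    u * bernstein u m' (fun i => f i.+1) + (1 - u) * bernstein u m' f
  else f 0%N.

Lemma bernstein_cst u m C : bernstein u m (fun=> C) = C.
Proof. by elim: m => //= m ->; ring. Qed.

Lemma bernsteinB u m f g :
  bernstein u m (fun i => f i - g i) = bernstein u m f - bernstein u m g.
Proof. by elim: m f g => //= m IH f g; rewrite !IH; ring. Qed.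

Lemma eq_bernstein u m f g : f =1 g -> bernstein u m f = bernstein u m g.
Proof. by move=> /funext ->. Qed.

Lemma le_bernstein u m f g : 0 <= u <= 1 ->
  (forall i, f i <= g i) -> bernstein u m f <= bernstein u m g.
Proof.
move=> /andP[u0 u1]; elim: m f g => //= m IH f g fg.
by apply: lerD; rewrite ler_wpM2l ?subr_ge0//; exact: IH.
Qed.

Lemma ler_norm_bernstein u m f : 0 <= u <= 1 ->
  `|bernstein u m f| <= bernstein u m (fun i => `|f i|).
Proof.
move=> /andP[u0 u1]; have u1' : 0 <= 1 - u by rewrite subr_ge0.
elim: m f => //= m IH f; apply: (le_trans (ler_normD _ _)).
rewrite (normrM u) (normrM (1 - u)) (ger0_norm u0) (ger0_norm u1').
by apply: lerD; rewrite ler_wpM2l.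
Qed.

Lemma ler_dist_bernstein u m f w : 0 <= u <= 1 ->
  `|bernstein u m f - w| <= bernstein u m (fun i => `|f i - w|).
Proof.
move=> u01; rewrite -{1}(bernstein_cst u m w) -bernsteinB.
exact: ler_norm_bernstein.
Qed.

(** The mean and variance of the binomial law in one formula; the shift [c] is general because a
    successful first trial replaces it by [1 + c]. *)
Lemma bernstein_quadratic u m (a b c : R) :
  bernstein u m (fun i => a + b * (i%:R + c) ^+ 2) =
  a + b * ((m%:R * u + c) ^+ 2 + m%:R * (u * (1 - u))).
Proof.
elim: m c => [|m IH] c /=; first by rewrite !mul0r addr0.
have -> : bernstein u m (fun i => a + b * (i.+1%:R + c) ^+ 2) =
   bernstein u m (fun i => a + b * (i%:R + (1 + c)) ^+ 2).
  by apply: eq_bernstein => i; rewrite -natr1 addrA.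
by rewrite !IH -natr1; ring.
Qed.

Lemma bernstein_variance u m (a b : R) : (0 < m)%N ->
  bernstein u m (fun i => a + b * (i%:R / m%:R - u) ^+ 2) =
  a + b * (u * (1 - u)) / m%:R.
Proof.
move=> m0; have m0' : m%:R != 0 :> R by rewrite pnatr_eq0 -lt0n.
have -> : bernstein u m (fun i => a + b * (i%:R / m%:R - u) ^+ 2) =
   bernstein u m (fun i => a + b / m%:R ^+ 2 * (i%:R + (- (m%:R * u))) ^+ 2).
  by apply: eq_bernstein => i; field.
by rewrite bernstein_quadratic; field.
Qed.

Definition bernstein2 u v m (G : nat -> nat -> R) : R :=
  bernstein u m (fun i => bernstein v m (G i)).

Lemma ler_norm_bernstein2 u v m G C : 0 <= u <= 1 -> 0 <= v <= 1 ->
  (forall i j, `|G i j| <= C) -> `|bernstein2 u v m G| <= C.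
Proof.
move=> u01 v01 GC; apply: (le_trans (ler_norm_bernstein _ _ _ u01)).
rewrite -[leRHS](bernstein_cst u m); apply: le_bernstein => // i.
apply: (le_trans (ler_norm_bernstein _ _ _ v01)).
by rewrite -[leRHS](bernstein_cst v m); exact: le_bernstein.
Qed.

(** Positivity passes the quadratic majorant through both averages, and each binomial variance
    [u (1 - u) / m] is at most [1 / m]. *)
Lemma bernstein2_approx u v m G w e C : 0 <= u <= 1 -> 0 <= v <= 1 ->
  (0 < m)%N -> 0 <= C ->
  (forall i j, `|G i j - w| <=
     e + C * ((i%:R / m%:R - u) ^+ 2 + (j%:R / m%:R - v) ^+ 2)) ->
  `|bernstein2 u v m G - w| <= e + 2 * C / m%:R.
Proof.
move=> u01 v01 m0 C0 Gw.
have var t : 0 <= t <= 1 -> C * (t * (1 - t)) / m%:R <= C / m%:R.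
  move=> /andP[t0 t1]; rewrite ler_wpM2r ?invr_ge0// ler_piMr//.
  by rewrite mulr_ile1 ?subr_ge0// gerBl.
apply: (@le_trans _ _ (bernstein u m (fun i =>
    (e + C * (v * (1 - v)) / m%:R) + C * (i%:R / m%:R - u) ^+ 2))).
  apply: (le_trans (ler_dist_bernstein _ _ _ _ u01)); apply: le_bernstein => // i.
  apply: (le_trans (ler_dist_bernstein _ _ _ _ v01)).
  apply: (@le_trans _ _ (bernstein v m (fun j =>
      (e + C * (i%:R / m%:R - u) ^+ 2) + C * (j%:R / m%:R - v) ^+ 2))).
    by apply: le_bernstein => // j; rewrite -addrA -mulrDr.
  by rewrite bernstein_variance// addrAC.
rewrite bernstein_variance// -addrA lerD2l.
by rewrite (_ : 2 * C / m%:R = C / m%:R + C / m%:R); [rewrite lerD ?var|ring].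
Qed.

End Bernstein.

(** * Inverting the sine near 0, and uniform continuity on a box *)

Section SineCoordinates.
Variable R : realType.

(** The derivative of [sin] is at least [cos 1] on [[-1, 1]], as [cos] is even and decreasing on
    [[0, pi]]. *)
Lemma sin_expansive (x y : R) : -1 <= x -> x <= y -> y <= 1 ->
  cos 1 * (y - x) <= sin y - sin x.
Proof.
move=> x1 xy y1.
have [|t /[!in_itv]/= /andP[xt ty] ->] :=
  MVT_segment xy (fun t _ => is_derive_sin t).
  exact/continuous_subspaceT/continuous_sin.
rewrite ler_wpM2r ?subr_ge0// -(cos_norm t).
have t1 : `|t| <= 1 by rewrite ler_norml (le_trans x1)// (le_trans ty).
have pi1 : 1 <= pi :> R by rewrite (le_trans _ (@pi_ge2 R))// ler1n.
rewrite leNgt ltr_cos ?in_itv/= ?ler01 ?normr_ge0 ?(le_trans t1)//.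
by rewrite -leNgt.
Qed.

(* [theta] is a left inverse of [sin] on [-1, 1], extended by constants. *)
Lemma clamped_arcsin : exists theta : R -> R, forall t, `|theta t| <= 1 /\
  forall x, `|x| <= 1 -> cos 1 * `|theta t - x| <= `|t - sin x|.
Proof.
suff H (t : R) : exists th : R, `|th| <= 1 /\
    forall x, `|x| <= 1 -> cos 1 * `|th - x| <= `|t - sin x|.
  by have [theta thetaP] := choice H; exists theta.
have N11 : -1 <= 1 :> R by lra.
have [t1|t1] := leP (sin 1) t.
  exists 1; rewrite normr1; split => // x; rewrite ler_norml => /andP[x0 x1].
  have := sin_expansive x 1 x0 x1 (lexx 1).
  rewrite ger0_norm ?subr_ge0// => /le_trans; apply.
  by rewrite (le_trans _ (ler_norm _))// lerD2r.
have [t0|t0] := leP t (sin (-1)).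
  exists (-1); rewrite normrN1; split => // x; rewrite ler_norml => /andP[x0 x1].
  have := sin_expansive (-1) x (lexx _) x0 x1.
  rewrite (distrC (-1)) (distrC t) ger0_norm ?subr_ge0// => /le_trans; apply.
  by rewrite (le_trans _ (ler_norm _))// lerD2l lerN2.
have cs : {within `[(-1), 1], continuous (@sin R)}.
  exact/continuous_subspaceT/continuous_sin.
have [|th /[!in_itv]/= /andP[th0 th1] <-] := @IVT R sin (-1) 1 t N11 cs.
  by rewrite ge_min le_max (ltW t0) (ltW t1) orbT.
exists th; rewrite ler_norml th0 th1; split => // x; rewrite ler_norml => /andP[x0 x1].
have [xth|/ltW thx] := leP x th.
  rewrite ger0_norm ?subr_ge0// (le_trans _ (ler_norm _))//.
  exact: sin_expansive.
rewrite (distrC th) (distrC (sin th)) ger0_norm ?subr_ge0// (le_trans _ (ler_norm _))//.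
exact: sin_expansive.
Qed.

(** Heine's theorem through the near-covering form of compactness; only [p] is confined to the
    box. *)
Lemma uniform_continuity_box (g : R * R -> R) (L e : R) : continuous g -> 0 < e ->
  exists2 d : R, 0 < d & forall p q : R * R, `|p.1| <= L -> `|p.2| <= L ->
    `|q.1 - p.1| < d -> `|q.2 - p.2| < d -> `|g q - g p| <= e.
Proof.
move=> cg e0.
pose K : set (R * R) := `[- L, L]%classic `*` `[- L, L]%classic.
have cK : compact K by apply: compact_setX; exact: segment_compact.
pose P (n : nat) (p : R * R) := forall q : R * R,
  `|q.1 - p.1| < n.+1%:R^-1 -> `|q.2 - p.2| < n.+1%:R^-1 -> `|g q - g p| <= e.
have : \forall n \near \oo, K `<=` P n.
  move/compact_near_coveringP : cK; apply => p0 _.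
  have e2 : 0 < e / 2 by rewrite divr_gt0.
  have /cvgrPdist_le/(_ _ e2) := cg p0.
  move=> /nbhs_ballP[d /= d0 dP].
  have d2 : 0 < d / 2 by rewrite divr_gt0.
  exists (ball p0 (d / 2), [set n : nat | n.+1%:R^-1 < d / 2]) => /=.
    split; first exact: nbhsx_ballx.
    have /cvgrPdist_lt/(_ _ d2) := @cvg_harmonic R.
    by apply: filterS => n /=; rewrite sub0r normrN ger0_norm// invr_ge0.
  move=> [p n] /= [[/= p1 p2] nd] q qp1 qp2.
  rewrite -(subrKA (g p0)) (le_trans (ler_normD _ _))// (splitr e) lerD//.
    rewrite distrC; apply: dP; split => /=; rewrite /ball/= in p1 p2 *.
      rewrite -(subrKA p.1) (le_lt_trans (ler_normD _ _))// (splitr d) ltrD//.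
      by rewrite distrC (lt_trans qp1).
    rewrite -(subrKA p.2) (le_lt_trans (ler_normD _ _))// (splitr d) ltrD//.
    by rewrite distrC (lt_trans qp2).
  apply: dP; split => /=; rewrite /ball/= in p1 p2 *.
    by rewrite (lt_trans p1)// ltr_pdivrMr// ltr_pMr// ltr1n.
  by rewrite (lt_trans p2)// ltr_pdivrMr// ltr_pMr// ltr1n.
move=> [n _ /(_ n (leqnn n)) Kn].
exists n.+1%:R^-1; first by rewrite invr_gt0.
move=> p q p1 p2; apply: Kn; split; rewrite /= in_itv/= -ler_norml//.
Qed.

End SineCoordinates.

(** * From trigonometric polynomials to bounded continuous functions *)

Section WeakConvergence.
Variable R : realType.
Local Notation mu2 := (@lebesgue_measure R \x @lebesgue_measure R)%E.
Local Notation dens := (gauss2_density (1 / 24)).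

Let v_gt0 : 0 < 1 / 24 :> R. Proof. by rewrite divr_gt0. Qed.

(** Brings the sine into [[0, 1]], the range of the parameter of a binomial law. *)
Definition unit_sin (x : R) : R := (1 + sin x) / 2.

Lemma unit_sin_itv (x : R) : 0 <= unit_sin x <= 1.
Proof.
have := sin_geN1 x; have := sin_le1 x; rewrite /unit_sin => h1 h2.
by apply/andP; split; lra.
Qed.

(** Each step of the Bernstein recursion only adds, scales and multiplies by a sine. *)
Lemma clt_modulated_bernstein (c d : R) (m : nat) (F : nat -> R * R -> R) :
  (forall i, clt_modulated R (F i)) -> clt_modulated R (fun z =>
    bernstein R (unit_sin (c * z.1 + d * z.2)) m (fun i => F i z)).
Proof.
elim: m F => [|m IH] F cF /=; first exact: cF.
pose A z := bernstein R (unit_sin (c * z.1 + d * z.2)) m (fun i => F i.+1 z).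
pose B z := bernstein R (unit_sin (c * z.1 + d * z.2)) m (fun i => F i z).
have cA : clt_modulated R A by exact: IH.
have cB : clt_modulated R B by exact: IH.
have -> : (fun z => unit_sin (c * z.1 + d * z.2) * A z +
                   (1 - unit_sin (c * z.1 + d * z.2)) * B z) =
  (fun z => (2^-1 * A z + 2^-1 * (sin (c * z.1 + d * z.2) * A z)) +
     (2^-1 * B z + (- 2^-1) * (sin (c * z.1 + d * z.2) * B z))).
  by apply/funext => z; rewrite /unit_sin; field.
by do 2 apply: clt_modulatedD; apply: clt_modulatedZ => //; exact: clt_modulated_sin.
Qed.

(* Bernstein polynomials in [sin (z.1 / L)] and [sin (z.2 / L)]: they approximate
   [g] uniformly on the box of radius [L] and stay bounded outside it. *)
Lemma trigonometric_approximation (g : R * R -> R) (M L e : R) : continuous g ->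
  (forall z, `|g z| <= M) -> 0 < L -> 0 < e ->
  exists2 P, clt_holds R P &
    forall z, `|g z - P z| <= e + 2 * M / L ^+ 2 * (z.1 ^+ 2 + z.2 ^+ 2).
Proof.
move=> cg gM L0 e0.
have M0 : 0 <= M by rewrite (le_trans _ (gM 0)).
have e2 : 0 < e / 2 by rewrite divr_gt0.
have [theta thetaP] := clamped_arcsin R.
have [d d0 dP] := uniform_continuity_box R g L (e / 2) cg e2.
have cos1 : 0 < cos 1 :> R by exact: cos1_gt0.
(* The Lipschitz constant for inverting [u] on the box: 2 from the halving in [unit_sin], [L] from
   the rescaling, [1 / cos 1] from the sine. *)
pose A := 2 * L / cos 1.
have A0 : 0 < A by rewrite divr_gt0 ?mulr_gt0.
(* Chosen so that [2 * M <= C * b ^+ 2] as soon as [d <= A * b]: at nodes farther than [d] the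
   trivial bound [2 * M] is then enough. *)
pose C := 2 * M * (A / d) ^+ 2.
have C0 : 0 <= C by rewrite mulr_ge0 ?sqr_ge0 ?mulr_ge0.
pose m := (Num.truncn (4 * C / e)).+1.
(* A point of the box with [u]-coordinate [i / m], when [u] takes that value on [[- L, L]]; in all
   cases [thetaP] bounds its distance to points of the box. *)
pose node (i : nat) := L * theta (2 * (i%:R / m%:R) - 1).
pose G i j := g (node i, node j).
pose u x := unit_sin (x / L).
exists (fun z => bernstein2 R (u z.1) (u z.2) m G).
  apply: clt_modulated_holds.
  have -> : (fun z : R * R => bernstein2 R (u z.1) (u z.2) m G) =
    (fun z => bernstein R (unit_sin (L^-1 * z.1 + 0 * z.2)) m (fun i =>
       bernstein R (unit_sin (0 * z.1 + L^-1 * z.2)) m (fun j => G i j))).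
    by apply/funext => z; rewrite /bernstein2 /u !mul0r addr0 add0r !(mulrC L^-1).
  apply: (clt_modulated_bernstein _ _ _ (fun i z =>
    bernstein R (unit_sin (0 * z.1 + L^-1 * z.2)) m (fun j => G i j))) => i.
  apply: (clt_modulated_bernstein _ _ _ (fun j _ => G i j)) => j.
  exact: clt_modulated_cst.
move=> z.
have q0 : 0 <= z.1 ^+ 2 + z.2 ^+ 2 by rewrite addr_ge0 ?sqr_ge0.
have L2 : 0 < L ^+ 2 by rewrite exprn_gt0.
(* Outside the box the trivial bound [2 * M] is at most the quadratic term, since one coordinate
   exceeds [L]. *)
have [/andP[z1 z2]|out] := boolP ((`|z.1| <= L) && (`|z.2| <= L)); last first.
  apply: (@le_trans _ _ (2 * M)).
    rewrite (le_trans (ler_normB _ _))// mulr_natl mulr2n lerD//.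
    by apply: ler_norm_bernstein2 => *; rewrite ?unit_sin_itv//; exact: gM.
  apply: ler_wpDl; first exact: ltW.
  have -> : 2 * M / L ^+ 2 * (z.1 ^+ 2 + z.2 ^+ 2) =
    2 * M * ((z.1 ^+ 2 + z.2 ^+ 2) / L ^+ 2) by ring.
  rewrite ler_peMr ?mulr_ge0// ler_pdivlMr// mul1r.
  move: out; rewrite negb_and -!ltNge => /orP[] zL.
    rewrite (@le_trans _ _ (z.1 ^+ 2)) ?lerDl ?sqr_ge0//.
    by rewrite -[z.1 ^+ 2]real_normK ?num_real// ler_pXn2r ?nnegrE ?(ltW L0)// ltW.
  rewrite (@le_trans _ _ (z.2 ^+ 2)) ?lerDr ?sqr_ge0//.
  by rewrite -[z.2 ^+ 2]real_normK ?num_real// ler_pXn2r ?nnegrE ?(ltW L0)// ltW.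
have nodeP i x : `|x| <= L -> `|node i - x| <= A * `|i%:R / m%:R - u x|.
  move=> xL; have [_ /(_ (x / L))] := thetaP (2 * (i%:R / m%:R) - 1).
  rewrite normrM normfV (gtr0_norm L0) ler_pdivrMr// mul1r => /(_ xL) H.
  have -> : node i - x = L * (theta (2 * (i%:R / m%:R) - 1) - x / L).
    by rewrite /node; field; rewrite gt_eqF.
  rewrite normrM (gtr0_norm L0) /A mulrAC ler_pdivlMr//.
  have tE : 2 * (i%:R / m%:R) - 1 - sin (x / L) = 2 * (i%:R / m%:R - u x).
    by rewrite /u /unit_sin; field; rewrite pnatr_eq0.
  move: H; rewrite tE (normrM 2) (gtr0_norm (_ : 0 < 2))// => H.
  rewrite -mulrA (mulrC _ (cos 1)) (mulrAC 2) (mulrC _ L).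
  by rewrite ler_wpM2l// ltW.
rewrite distrC; apply: (@le_trans _ _ e); last first.
  by rewrite lerDl (mulr_ge0 (divr_ge0 (mulr_ge0 (ler0n R 2) M0) (ltW L2)) q0).
apply: (@le_trans _ _ (e / 2 + 2 * C / m%:R)).
  apply: bernstein2_approx; rewrite ?unit_sin_itv// => i j.
  have quad a b : 0 <= b -> d <= A * b -> a = b -> 2 * M <= C * a ^+ 2.
    move=> b0 dA ->; rewrite /C -mulrA ler_peMr ?mulr_ge0// -exprMn.
    have Ab0 : 0 <= A / d * b by rewrite mulr_ge0// divr_ge0// ltW.
    by rewrite expr_ge1// mulrAC ler_pdivlMr// mul1r.
  have G2M : `|G i j - g z| <= 2 * M.
    by rewrite (le_trans (ler_normB _ _))// mulr_natl mulr2n lerD ?gM.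
  rewrite -(real_normK (num_real (i%:R / m%:R - _))).
  rewrite -(real_normK (num_real (j%:R / m%:R - _))).
  have n1 := nodeP i _ z1; have n2 := nodeP j _ z2.
  have [h1|h1] := ltP `|node i - z.1| d; last first.
    rewrite (le_trans G2M)// mulrDr.
    have := quad _ _ (normr_ge0 (i%:R / m%:R - u z.1)) (le_trans h1 n1) erefl.
    move=> h; rewrite (le_trans h)// addrA addrAC -[leLHS]add0r lerD2r.
    by rewrite (addr_ge0 (ltW e2) (mulr_ge0 C0 (sqr_ge0 _))).
  have [h2|h2] := ltP `|node j - z.2| d; last first.
    rewrite (le_trans G2M)// mulrDr.
    have := quad _ _ (normr_ge0 (j%:R / m%:R - u z.2)) (le_trans h2 n2) erefl.
    move=> h; rewrite (le_trans h)// addrA -[leLHS]add0r lerD2r.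
    by rewrite (addr_ge0 (ltW e2) (mulr_ge0 C0 (sqr_ge0 _))).
  rewrite (le_trans (dP z (node i, node j) z1 z2 h1 h2))// lerDl.
  by rewrite (mulr_ge0 C0 (addr_ge0 (sqr_ge0 _) (sqr_ge0 _))).
rewrite [leRHS](splitr e) lerD2l ler_pdivrMr ?ltr0n//.
have : 4 * C / e < m%:R by exact: truncnS_gt.
by rewrite ltr_pdivrMr// => h; nra.
Qed.

(** For the product sigma-algebra, [g] is a pointwise limit of measurable trigonometric
    approximations, with box radius [n + 1] and precision [1 / (n + 1)]. *)
Lemma continuous_bounded_measurable (g : R * R -> R) (M : R) : continuous g ->
  (forall z, `|g z| <= M) -> measurable_fun setT g.
Proof.
move=> cg gM.
have /choice[P PP] (n : nat) : exists P : R * R -> R, measurable_fun setT P /\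
    forall z, `|g z - P z| <= n.+1%:R^-1 + 2 * M / n.+1%:R ^+ 2 * (z.1 ^+ 2 + z.2 ^+ 2).
  have [||P [mP _ _] PP] := trigonometric_approximation g M n.+1%:R n.+1%:R^-1 cg gM.
  - by rewrite ltr0n.
  - by rewrite invr_gt0 ltr0n.
  by exists P.
apply: (@measurable_fun_cvg _ _ _ _ P) => [n|z _]; first by case: (PP n).
have M0 : 0 <= M by rewrite (le_trans _ (gM 0)).
have q0 : 0 <= z.1 ^+ 2 + z.2 ^+ 2 by rewrite addr_ge0 ?sqr_ge0.
apply/subr_cvg0; apply: norm_cvg0.
apply: (@squeeze_cvgr _ _ _ _ (cst 0)
  (fun n => (1 + 2 * M * (z.1 ^+ 2 + z.2 ^+ 2)) * harmonic n)).
- apply: nearW => n; rewrite normr_ge0/= distrC.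
  have [_ /(_ z) h] := PP n; rewrite (le_trans h)// /harmonic/= -exprVn.
  set w := n.+1%:R^-1; have w0 : 0 <= w by rewrite invr_ge0.
  have w1 : w <= 1 by rewrite invf_le1 ?ltr0n// ler1n.
  rewrite [leRHS]mulrDl mul1r lerD2l (_ : 2 * M * w ^+ 2 * _ =
    2 * M * (z.1 ^+ 2 + z.2 ^+ 2) * w * w); last by ring.
  by rewrite ler_piMr// mulr_ge0// mulr_ge0// mulr_ge0.
- exact: cvg_cst.
- rewrite -[X in _ --> X](mulr0 (1 + 2 * M * (z.1 ^+ 2 + z.2 ^+ 2))).
  by apply: cvgM; [exact: cvg_cst|exact: cvg_harmonic].
Qed.

Lemma gauss_mean_dist_le (F G h : R * R -> R) (A B C : R) :
  measurable_fun setT F -> (forall z, `|F z| <= A) ->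
  measurable_fun setT G -> (forall z, `|G z| <= B) ->
  measurable_fun setT h -> (forall z, `|h z| <= C * ((1 + z.1 ^+ 2) * (1 + z.2 ^+ 2))) ->
  (forall z, `|F z - G z| <= h z) ->
  `|gauss_mean R F - gauss_mean R G| <= gauss_mean R h.
Proof.
move=> mF FA mG GB mh hC FG.
have iF := integrable_bounded_gauss2 R _ v_gt0 F A mF FA.
have iG := integrable_bounded_gauss2 R _ v_gt0 G B mG GB.
have ih := integrable_gauss2 R _ v_gt0 h C mh hC.
rewrite /gauss_mean -RintegralB//.
have iFG : mu2.-integrable setT (EFin \o (fun z => F z * dens z - G z * dens z)).
  rewrite /comp; under eq_fun do rewrite EFinB.
  exact: integrableB.
apply: (le_trans (le_normr_Rintegral measurableT iFG)).
apply: le_Rintegral => //.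
  exact: (integrable_norm iFG).
move=> z _; rewrite -mulrBl normrM (ger0_norm (gauss2_density_ge0 _ _ v_gt0 z)).
by rewrite ler_wpM2r// gauss2_density_ge0.
Qed.

(** Three-term comparison through a trigonometric approximation [P]: the limit is known for [P], and
    second moments control both replacements of [g] by [P]. *)
Lemma Eperm_gauss_cvg (g : R * R -> R) (M : R) : continuous g ->
  (forall z, `|g z| <= M) ->
  Eperm R n (fun s => g (XY R s)) @[n --> \oo] --> gauss_mean R g.
Proof.
move=> cg gM.
have M0 : 0 <= M by rewrite (le_trans _ (gM 0)).
have mg := continuous_bounded_measurable g M cg gM.
pose q (z : R * R) := z.1 ^+ 2 + z.2 ^+ 2.
have q0 z : 0 <= q z by rewrite addr_ge0 ?sqr_ge0.
have mq : measurable_fun setT q.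
  by apply: measurable_funD; apply: measurable_funX;
    [exact: measurable_fst|exact: measurable_snd].
have q1 z : q z <= (1 + z.1 ^+ 2) * (1 + z.2 ^+ 2).
  have := mulr_ge0 (sqr_ge0 z.1) (sqr_ge0 z.2).
  by rewrite /q; move: (z.1 ^+ 2) (z.2 ^+ 2) => a b; nra.
have p1 z : 1 <= (1 + z.1 ^+ 2) * (1 + z.2 ^+ 2) :> R.
  have := mulr_ge0 (sqr_ge0 z.1) (sqr_ge0 z.2).
  have := sqr_ge0 z.1; have := sqr_ge0 z.2.
  by move: (z.1 ^+ 2) (z.2 ^+ 2) => a b; nra.
have iq : mu2.-integrable setT (fun z => (q z * dens z)%:E).
  apply: (integrable_gauss2 R _ v_gt0 _ 1) => // z.
  by rewrite ger0_norm// mul1r.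
have i1 : mu2.-integrable setT (fun z => (dens z)%:E).
  have -> : (fun z => (dens z)%:E) = (fun z : R * R => (1 * dens z)%:E).
    by apply/funext => z; congr EFin; symmetry; exact: mul1r.
  by apply: (integrable_bounded_gauss2 R _ v_gt0 (fun=> 1) 1) => // z; rewrite normr1.
pose m2 := gauss_mean R q.
have m20 : 0 <= m2.
  by apply: Rintegral_ge0 => z _; rewrite mulr_ge0 ?gauss2_density_ge0.
apply/cvgrPdist_le => e e0.
pose B := 2 * M * (8 + m2).
have B0 : 0 <= B by exact: mulr_ge0 (mulr_ge0 (ler0n R 2) M0) (addr_ge0 (ler0n R 8) m20).
(* Since [L >= 1] and [L >= 4 * B / e], one gets [B / L ^+ 2 <= e / 4]. In [B], 8 bounds the second
   moments of [X_n] and [Y_n] together and [m2] is that of the Gaussian. *)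
pose L := 1 + 4 * B / e.
have L1 : 1 <= L by rewrite lerDl (divr_ge0 (mulr_ge0 (ler0n R 4) B0) (ltW e0)).
have L0 : 0 < L by rewrite (lt_le_trans _ L1).
have e4 : 0 < e / 4 by rewrite divr_gt0.
have [P [mP [A PA] cP] gP] := trigonometric_approximation g M L (e / 4) cg gM L0 e4.
pose k := 2 * M / L ^+ 2.
have k0 : 0 <= k by exact: divr_ge0 (mulr_ge0 (ler0n R 2) M0) (sqr_ge0 L).
have kB : k * (8 + m2) <= e / 4.
  have -> : k * (8 + m2) = B / L ^+ 2 by rewrite /k /B mulrAC.
  rewrite ler_pdivrMr ?exprn_gt0//.
  rewrite (@le_trans _ _ (e / 4 * L))//.
    rewrite /L mulrDr mulr1 (_ : e / 4 * (4 * B / e) = B) ?lerDr ?ltW//.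
    by field; rewrite gt_eqF.
  by rewrite ler_wpM2l ?(ltW e4)// expr2 ler_peMr// ltW.
have gaussP : `|gauss_mean R g - gauss_mean R P| <= e / 4 + k * m2.
  pose h z := e / 4 + k * q z.
  have -> : e / 4 + k * m2 = gauss_mean R h.
    rewrite /gauss_mean /h; under eq_Rintegral do rewrite mulrDl.
    have i2 : mu2.-integrable setT (EFin \o (fun z => e / 4 * dens z)).
      by rewrite /comp; under eq_fun do rewrite EFinM; exact: integrableZl.
    have i3 : mu2.-integrable setT (EFin \o (fun z => k * (q z * dens z))).
      by rewrite /comp; under eq_fun do rewrite EFinM; exact: integrableZl.
    under eq_Rintegral do rewrite -(mulrA k).
    rewrite RintegralD// (RintegralZl _ measurableT i1).
    by rewrite (RintegralZl _ measurableT iq) gauss2_mass// mulr1.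
  apply: (gauss_mean_dist_le g P h M A (e / 4 + k)) => //.
    by apply: measurable_funD => //; exact: measurable_funM.
  move=> z; rewrite ger0_norm; last exact: addr_ge0 (ltW e4) (mulr_ge0 k0 (q0 z)).
  rewrite mulrDl; apply: lerD; last by rewrite ler_wpM2l.
  by rewrite ler_peMr// ltW.
have permP n : (2 < n)%N -> `|Eperm R n (fun s => g (XY R s)) -
    Eperm R n (fun s => P (XY R s))| <= e / 4 + k * 8.
  move=> n2; rewrite -EpermB (le_trans (ler_norm_Eperm _ _ _))//.
  apply: (@le_trans _ _ (Eperm R n (fun s =>
    e / 4 + k * (XY R s).1 ^+ 2 + k * (XY R s).2 ^+ 2))).
    by apply: le_Eperm => s; rewrite -addrA -mulrDr; exact: gP.
  rewrite !EpermD Eperm_cst !EpermZ -addrA lerD2l -mulrDr ler_wpM2l//.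
  rewrite (_ : 8 = 4 + 4); last by ring.
  have := Eperm_XY_sqr_le R n 1 0 n2; have := Eperm_XY_sqr_le R n 0 1 n2.
  rewrite !normr0 !normr1 addr0 add0r expr1n mulr1 => h1 h2.
  apply: lerD; [apply: le_trans h2|apply: le_trans h1];
    by apply: le_Eperm => s; rewrite mul1r mul0r ?addr0 ?add0r.
have /cvgrPdist_le/(_ _ e4) Pn := cP.
near=> n.
have n2 : (2 < n)%N by near: n; exact: nbhs_infty_gt.
have h1 : `|gauss_mean R P - Eperm R n (fun s => P (XY R s))| <= e / 4 by near: n.
have h2 := permP n n2; rewrite distrC in h2.
apply: (le_trans (ler_distD (gauss_mean R P) _ _)).
have h3 := ler_distD (Eperm R n (fun s => P (XY R s))) (gauss_mean R P)
  (Eperm R n (fun s => g (XY R s))).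
apply: (le_trans (lerD gaussP (le_trans h3 (lerD h1 h2)))).
by move: kB; rewrite mulrDr; move: (k * 8) (k * m2) => a b; lra.
Unshelve. all: by end_near. Qed.

End WeakConvergence.

(* Weak convergence: E[g(X_n,Y_n)] -> \int g dN(0, diag(1/24,1/24))
   for every bounded continuous g : R^2 -> R. *)
Theorem theorem1 (R : realType) :
  forall g : R * R -> R,
    continuous g ->
    (exists M : R, forall z, `|g z| <= M) ->
    (fun n : nat => (expect_perm n g)%:E) @ \oo -->
      (\int[(@lebesgue_measure R \x @lebesgue_measure R)%E]_z
         (g z * gauss2_density (1 / 24) z)%:E)%E.
Proof.
move=> g cg [M gM].
have v_gt0 : 0 < 1 / 24 :> R by rewrite divr_gt0.
have mg := continuous_bounded_measurable R g M cg gM.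
have ig := integrable_bounded_gauss2 R _ v_gt0 g M mg gM.
(* The integral is finite because [g] is bounded, so the limit in the extended reals reduces to a
   real one. *)
rewrite -[X in _ --> X]fineK; last exact: integrable_fin_num.
apply: cvg_EFin; first exact: nearW.
exact: Eperm_gauss_cvg cg gM.
Qed.
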